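(* Suppose $(T;C_1,\dots,C_w)$ forms a $w$-wheel ($w\ge4$) with sectors $S_1,\dots,S_w$ (indices modulo $w$), and let $X$ be any $\kappa$-cut. Then at least one of the following holds: 1. $X=C(i,j)$ for some $i\neq j$; 2. $X\subseteq C(i,i+1)\cup S_i$ for some $i$ (so $X$ is a laminar cut of $C(i,i+1)$); 3. for some $i$, $X$ is a crossing matching cut (in some side, with respect to some nonempty subset) of $C(i,i+1)$ or of $C(i,i+2)$, where that cut has exactly two sides; 4. $X$ is $(\mathrm{I},\kappa-1)$-small; 5. $(T;C_1,\dots,C_w)$ is a small wheel; 6. there exist $i<j$ with $X\subseteq S_i\cup T\cup S_j$ such that $(T;C_1,\dots,C_i,X\cap S_i,C_{i+1},\dots,C_j,X\cap S_j,C_{j+1},\dots,C_w)$ forms a $(w+2)$-wheel; or there exist $i\neq j$ with $X\subseteq S_i\cup T\cup C_j$ such that $(T;C_1,\dots,C_i,X\cap S_i,C_{i+1},\dots,C_w)$ forms a $(w+1)$-wheel.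
   Context: Standing conventions: $G=(V,E)$ is a finite, simple, connected, undirected, non-complete graph with $n=|V|$; $\kappa$ is its vertex connectivity, assumed to satisfy $\kappa<n/4$. A cut is a set $U\subset V$ whose removal disconnects $G$; a $\kappa$-cut is a cut of size $\kappa$; a side of a cut $U$ is a connected component of the subgraph induced on $V\setminus U$. A set $S$ disconnects $P$ from the rest of the graph if $P\ne\emptyset$, $P\cap S=\emptyset$, $V\setminus(S\cup P)\ne\emptyset$ and every path from $P$ to $V\setminus(S\cup P)$ meets $S$. A laminar cut of $U$ in side $P$ is a cut $W\subseteq U\cup P$. A cut with sides $A_1,\dots,A_a$ is $(\mathrm{I},t)$-small if $\sum_{i\neq i^\sharp}|A_i|\le t$ for some index $i^\sharp$. Wheels: for $w\ge4$ (indices modulo $w$), if $V$ is partitioned into pairwise disjoint sets $T,C_1,\dots,C_w,S_1,\dots,S_w$ with all $C_i,S_i$ nonempty ($T$ may be empty) such that for every $i$ the set $C_i\cup T\cup C_{i+2}$ is a $\kappa$-cut that disconnects $S_i\cup C_{i+1}\cup S_{i+1}$ from the rest of the graph, then $(T;C_1,\dots,C_w)$ forms a $w$-wheel with sectors $S_1,\dots,S_w$. $C(i,j)=C_i\cup T\cup C_j$. The wheel is a small wheel if there is an index $i^\sharp$ with $\sum_{i\neq i^\sharp}|S_i|\le\kappa$. Matching cuts: for a cut $U$, a side $A$ of $U$, and $P\subseteq U$, a $\kappa$-cut $W$ is a matching cut of $U$ in side $A$ with respect to $P$ if (i) $U\setminus P\subseteq W\subseteq U\cup A$, (ii) $A\setminus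 W\ne\emptyset$, (iii) $P\cup(V\setminus(U\cup A))$ and $A\setminus W$ are disjoint from $W$ and every path between them meets $W$. If $U$ has exactly two sides $A,B$ and $\emptyset\ne P\subseteq U$, a $\kappa$-cut $W$ is a crossing matching cut of $U$ in side $A$ with respect to $P$ if $W\cap B\neq\emptyset$ and $(U\setminus P)\cup(W\cap A)$ is a matching cut of $U$ in side $A$ with respect to $P$. *)

(* Defs.v *)
From mathcomp Require Import all_boot.
Set Implicit Arguments.
Unset Strict Implicit.
Unset Printing Implicit Defensive.

(* Simple graph: V finite vertex type, e : rel V (assumed symmetric and
   irreflexive in the theorem). Wheel indices are 0-based and taken modulo
   the number of spokes w = size cs. *)

Section Graph.
Variables (V : finType) (e : rel V).

Definition avoid_rel (U : {set V}) : rel V :=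
  fun u v => [&& e u v, u \notin U & v \notin U].

Definition is_cut (U : {set V}) : bool :=
  [exists x, exists y,
     [&& x \notin U, y \notin U & ~~ connect (avoid_rel U) x y]].

Definition kappa : nat := \big[minn/#|V|]_(U : {set V} | is_cut U) #|U|.

Definition kcut (U : {set V}) : bool := is_cut U && (#|U| == kappa).

Definition side (U : {set V}) (x : V) : {set V} :=
  [set y | (y \notin U) && connect (avoid_rel U) x y].

Definition sides (U : {set V}) : {set {set V}} := [set side U x | x in ~: U].

(* every path between P and Q meets S (P, Q disjoint from S assumed separately) *)
Definition separated (S P Q : {set V}) : bool :=
  [forall x in P, forall y in Q, ~~ connect (avoid_rel S) x y].

Definition disconnects (S P : {set V}) : bool :=
  [&& P != set0, [disjoint P & S], ~: (S :|: P) != set0 &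
      separated S P (~: (S :|: P))].

Definition laminar_cut (U P W : {set V}) : bool := is_cut W && (W \subset U :|: P).

Definition matching_cut (U A P W : {set V}) : bool :=
  [&& A \in sides U, P \subset U, kcut W,
      (U :\: P) \subset W, W \subset U :|: A, A :\: W != set0,
      [disjoint P :|: ~: (U :|: A) & W], [disjoint A :\: W & W] &
      separated W (P :|: ~: (U :|: A)) (A :\: W)].

Definition crossing_matching_cut (U A P W : {set V}) : Prop :=
  exists B : {set V},
    sides U = [set A; B] /\ A != B /\ P != set0 /\ P \subset U /\
    kcut W /\ W :&: B != set0 /\
    matching_cut U A P ((U :\: P) :|: (W :&: A)).

Definition small_cut (t : nat) (X : {set V}) : Prop :=
  exists2 A0, A0 \in sides X & \sum_(A in sides X | A != A0) #|A| <= t.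

Definition cyc (s : seq {set V}) (i : nat) : {set V} := nth set0 s (i %% size s).

Definition Cij (T : {set V}) (cs : seq {set V}) (i j : nat) : {set V} :=
  cyc cs i :|: T :|: cyc cs j.

Definition is_wheel (T : {set V}) (cs ss : seq {set V}) : Prop :=
  let w := size cs in
  4 <= w /\ size ss = w /\
  (forall i, i < w -> cyc cs i != set0 /\ cyc ss i != set0) /\
  (forall i j, i < w -> j < w ->
     [disjoint cyc cs i & cyc ss j] /\
     (i != j -> [disjoint cyc cs i & cyc cs j] /\ [disjoint cyc ss i & cyc ss j])) /\
  (forall i, i < w -> [disjoint T & cyc cs i :|: cyc ss i]) /\
  (forall v, v \in T \/ exists2 i, i < w & v \in cyc cs i :|: cyc ss i) /\
  (forall i, i < w ->
     kcut (Cij T cs i i.+2) /\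
     disconnects (Cij T cs i i.+2) (cyc ss i :|: cyc cs i.+1 :|: cyc ss i.+1)).

Definition forms_wheel (T : {set V}) (cs : seq {set V}) : Prop :=
  exists ss, is_wheel T cs ss.

Definition small_wheel (ss : seq {set V}) : Prop :=
  exists2 i0, i0 < size ss &
    \sum_(i < size ss | i != i0 :> nat) #|nth set0 ss i| <= kappa.

End Graph.

(* Main.v *)
Require Import Defs.
From mathcomp Require Import all_boot zify.

(* A kappa-cut X that is not small comes with a separation A | X | B whose two
   parts have at least kappa vertices.  Submodularity of vertex boundaries,
   applied to the four corners of X and another kappa-cut U with regions A', B',
   shows that if X meets both A' and B' and contains neither, then U has exactly
   these two sides and either some corner is empty (X is then a crossing matching
   cut of U) or all four corners are nonempty and the four arms have equal size.

   Taking U = C(i,i+1), each sector S_i is disjoint from X, contained in X, or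
   properly crossed with four nonempty corners.  A sector disjoint from X lies
   in A or in B and drags the adjacent spokes along.  If no sector meets X, then
   X = C(i,j).  A sector disjoint from X next to one contained in X leaves a
   corner of C(i,i+2) empty, which confines X; hence, unless the wheel is small,
   if some sector meets X but none is properly
   crossed, X lies in one closed sector.  If one or two sectors are properly
   crossed, the others are disjoint from X, and counting the arms shows that X
   refines the wheel. *)

Set Implicit Arguments.
Unset Strict Implicit.
Unset Printing Implicit Defensive.

(* [lia] after dropping the memberships and congruences, which it would saturate. *)
Ltac nlia :=
  repeat match goal with
  | H : ?P |- _ =>
    lazymatch type of P with
    | Prop =>
      lazymatch P with
      | context [@in_mem] => clear H
      | context [modn] => clear H
      | is_true (leq _ _) => fail
      | is_true (andb (leq _ _) _) => fail
      | is_true (negb (eq_op _ _)) => fail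
      | @eq nat _ _ => fail
      | _ => clear H
      end
    end
  end; lia.

(** * Separations *)

Section Separations.
Variables (V : finType) (e : rel V).
Hypothesis esym : symmetric e.
Implicit Types A B D U X Z : {set V}.

(** The sum condition says that the three sets partition [V]; in this form set identities reduce to
    case analysis on membership bits. [A] and [B] may each be a union of several sides of [X]. *)
Record sep A X B : Prop := Sep {
  sepA : exists x, x \in A;
  sepB : exists x, x \in B;
  sepD : forall v, (v \in A) + (v \in X) + (v \in B) = 1;
  sepE : forall x y, x \in A -> y \in B -> e x y = false }.

Lemma sepC A X B : sep A X B -> sep B X A.
Proof.
case=> hA hB hD hE; split=> // [v|x y xB yA]; last by rewrite esym hE.
by rewrite -(hD v) addnC addnA addnAC.
Qed.

Lemma card_indicator D : #|D| = \sum_v (v \in D : nat).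
Proof. by rewrite -sum1_card big_mkcond; apply: eq_bigr => v _; case: (v \in D). Qed.

Lemma card_sep A X B Z : sep A X B -> #|Z| = #|Z :&: A| + #|Z :&: X| + #|Z :&: B|.
Proof.
move=> h; rewrite !card_indicator -!big_split; apply: eq_bigr => v _ /=.
by rewrite !inE; move: (sepD h v); do ![case: (v \in _)].
Qed.

Lemma avoid_closed U D x y :
  (forall u v, u \in D -> v \notin U -> e u v -> v \in D) ->
  x \in D -> connect (avoid_rel e U) x y -> y \in D.
Proof.
move=> hD + /connectP [p + ->]; elim: p x => //= z p IH x xD /andP[/and3P[exz _ zU] hp].
by apply: IH hp; apply: hD exz.
Qed.

Lemma sep_nconnect A X B x y : sep A X B -> x \in A -> y \in B ->
  ~~ connect (avoid_rel e X) x y.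
Proof.
move=> h xA yB; apply/negP=> /(@avoid_closed X A) hc.
have yA: y \in A.
  apply: hc => // u v uA vX euv; have := sepE h uA (y := v); rewrite euv.
  by move: (sepD h v) vX; do ![case: (v \in _)] => //= _ _ /(_ isT).
by move: (sepD h y); rewrite yA yB; case: (_ \in X).
Qed.

Lemma kappa_min U : is_cut e U -> kappa e <= #|U|.
Proof.
move=> hU; rewrite /kappa; have := mem_index_enum U.
elim: (index_enum _) => //= W s IH; rewrite inE big_cons => /orP[/eqP <-|/IH le_s].
  by rewrite hU geq_minl.
by case: ifP => // _; apply: leq_trans le_s; rewrite geq_minr.
Qed.

Lemma sep_cut A X B : sep A X B -> is_cut e X.
Proof.
move=> h; have [x xA] := sepA h; have [y yB] := sepB h.
apply/existsP; exists x; apply/existsP; exists y; rewrite (sep_nconnect h) // andbT.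
move: (sepD h x) (sepD h y); rewrite xA yB.
by case: (x \in X); case: (y \in X); rewrite ?addn1 ?addn2.
Qed.

Lemma kappa_sep A X B : sep A X B -> kappa e <= #|X|.
Proof. by move/sep_cut; apply: kappa_min. Qed.

Lemma sep_compl A X : [disjoint A & X] -> A != set0 -> ~: (A :|: X) != set0 ->
  (forall u v, u \in A -> v \notin X -> e u v -> v \in A) -> sep A X (~: (A :|: X)).
Proof.
move=> dAX /set0Pn[x xA] /set0Pn[y yB] hE; split; [by exists x|by exists y| |].
  move=> v; rewrite !inE; have := disjointFr dAX (x := v).
  by case: (v \in A); case: (v \in X) => // /(_ isT).
move=> u v uA; rewrite !inE negb_or => /andP[vA vX].
by apply/negP => euv; move/negP: vA; apply; apply: hE euv.
Qed.

Lemma disconnects_sep S P : disconnects e S P -> sep P S (~: (P :|: S)).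
Proof.
case/and4P=> P0 dPS R0; rewrite setUC in R0; move=> /forall_inP hs.
apply: sep_compl => // u v uP vS euv; apply/negPn/negP => vP.
have := hs _ uP => /forall_inP /(_ v); rewrite !inE negb_or vS vP => /(_ isT).
case/negP; apply: connect1; rewrite /avoid_rel euv vS andbT /=.
by rewrite (disjointFr dPS).
Qed.

Lemma sep_disconnects P S B : sep P S B -> disconnects e S P.
Proof.
move=> h; have [x xP] := sepA h; have [y yB] := sepB h.
have hR v : v \in ~: (S :|: P) -> v \in B.
  by rewrite !inE; move: (sepD h v); do ![case: (v \in _)].
apply/and4P; split.
- by apply/set0Pn; exists x.
- rewrite disjoint_subset; apply/subsetP => v vP; rewrite !inE.
  by move: (sepD h v); rewrite vP; case: (_ \in S).
- apply/set0Pn; exists y; rewrite !inE; move: (sepD h y); rewrite yB.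
  by do ![case: (y \in _)].
apply/forall_inP=> u uP; apply/forall_inP=> v /hR vB.
exact: sep_nconnect h uP vB.
Qed.

Lemma side_closed U x u v :
  u \in side e U x -> v \notin U -> e u v -> v \in side e U x.
Proof.
rewrite !inE => /andP[uU xu] vU euv; rewrite vU /=.
by apply: connect_trans xu _; apply: connect1; rewrite /avoid_rel euv uU vU.
Qed.

Lemma side_refl U x : x \notin U -> x \in side e U x.
Proof. by rewrite inE connect0 andbT. Qed.

Lemma avoid_sym U : symmetric (avoid_rel e U).
Proof. by move=> x y; rewrite /avoid_rel esym [X in _ && X]andbC. Qed.

Lemma side_disjoint U x : [disjoint side e U x & U].
Proof. by rewrite disjoint_subset; apply/subsetP => v; rewrite !inE => /andP[]. Qed.

Lemma cut_sep U : is_cut e U -> exists2 x, x \notin U & sep (side e U x) U (~: (side e U x :|: U)).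
Proof.
case/existsP=> x /existsP[y /and3P[xU yU nc]]; exists x => //.
apply: sep_compl; last by move=> u v; apply: side_closed.
- exact: side_disjoint.
- by apply/set0Pn; exists x; rewrite side_refl.
- by apply/set0Pn; exists y; rewrite !inE (negbTE yU) orbF.
Qed.

Lemma kcut_sep A X B : sep A X B -> #|X| = kappa e -> kcut e X.
Proof. by move=> /sep_cut h1 h2; rewrite /kcut h1 h2 eqxx. Qed.

(* Submodularity enters only through this bound, applied to opposite corners. *)
Lemma corner A X B A' U B' x : sep A X B -> sep A' U B' -> x \in A -> x \in A' ->
  kappa e <= #|X :&: A'| + #|X :&: U| + #|U :&: A|.
Proof.
move=> h h' xA xA'.
(* [W] contains every outside neighbour of the corner [A :&: A'] and no vertex of [B], so it is a
   cut. *)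
pose W := X :&: A' :|: X :&: U :|: U :&: A.
have hW : sep (A :&: A') W (~: (A :&: A' :|: W)).
  apply: sep_compl.
  - rewrite disjoint_subset; apply/subsetP => v; rewrite !inE.
    by move: (sepD h v) (sepD h' v); do ![case: (v \in _)].
  - by apply/set0Pn; exists x; rewrite inE xA.
  - have [y yB] := sepB h; apply/set0Pn; exists y; rewrite !inE.
    by move: (sepD h y) (sepD h' y); rewrite yB; do ![case: (y \in _)].
  move=> u v; rewrite !inE => /andP[uA uA'] vW euv.
  have := sepE h uA (y := v); have := sepE h' uA' (y := v); rewrite euv.
  move: (sepD h v) (sepD h' v) vW.
  by do ![case: (v \in _)] => //= _ _ _; do ?[move=> /(_ isT)] => //; move=> _ /(_ isT).
apply: leq_trans (kappa_sep hW) _.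
by apply: leq_trans (leq_card_setU _ _) _; rewrite leq_add2r leq_card_setU.
Qed.

(** If [u] had no neighbour in [D], moving it to the other part would leave a separation by
    [U :\ u], which has fewer than kappa vertices. *)
Lemma cut_neighbor D U E u : sep D U E -> #|U| = kappa e -> u \in U ->
  exists2 x, x \in D & e u x.
Proof.
move=> h cU uU; apply/exists_inP/contraT; rewrite negb_exists_in => /forall_inP hn.
have hs : sep D (U :\ u) (E :|: [set u]).
  split; [exact: sepA h| by exists u; rewrite !inE eqxx orbT| |].
    move=> v; rewrite !inE; have := sepD h v; case: (eqVneq v u) => [->|_] /=.
      by rewrite uU; do ![case: (u \in _)].
    by rewrite orbF.
  move=> x y xD; rewrite !inE => /orP[|/eqP ->]; first exact: (sepE h xD).
  by rewrite esym; apply/negbTE/hn.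
by have := kappa_sep hs; rewrite -cU (cardsD1 u U) uU; lia.
Qed.

(** The working form of a kappa-cut that is not small: its sides are grouped into two parts of at
    least kappa vertices each. *)
Definition big_sep A X B : Prop :=
  [/\ sep A X B, #|X| = kappa e, kappa e <= #|A| & kappa e <= #|B|].

Lemma big_sepC A X B : big_sep A X B -> big_sep B X A.
Proof. by case=> /sepC. Qed.

(** Inclusion would force [A = U] by size, so [X] and [B] would avoid [U]. A region of [U] meeting
    [B] then holds at least kappa vertices of [X] by the corner bound, and a region missing [B] is
    contained in [X]. Since [B] meets some region, the two counts exceed [#|X|]. *)
Lemma big_not_sub A X B A' U B' : big_sep A X B -> sep A' U B' -> #|U| = kappa e ->
  ~~ (A \subset U).
Proof.
case=> h cX cA _ h' cU; apply/negP => sAU.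
have eAU : A = U by apply/eqP; rewrite eqEcard sAU cU.
have [a aA] := sepA h; have k0 : 0 < kappa e by rewrite -cU -eAU; apply/card_gt0P; exists a.
have XU0 : X :&: U = set0.
  by apply/setP=> v; rewrite -eAU !inE; move: (sepD h v); do ![case: (v \in _)].
have UB0 : U :&: B = set0.
  by apply/setP=> v; rewrite -eAU !inE; move: (sepD h v); do ![case: (v \in _)].
have cXU := card_sep X h'; rewrite XU0 cards0 in cXU.
have half A1 B1 : sep A1 U B1 -> B :&: A1 != set0 -> kappa e <= #|X :&: A1|.
  move=> h1 /set0Pn[b]; rewrite inE => /andP[bB bA1].
  by have := corner (sepC h) h1 bB bA1; rewrite XU0 UB0 cards0 !addn0.
have other A1 B1 : sep A1 U B1 -> B :&: A1 = set0 -> 0 < #|X :&: A1|.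
  move=> h1 /setP e0; have [x xA1] := sepA h1; apply/card_gt0P; exists x.
  have := e0 x; have := sepD h x; have := sepD h1 x; rewrite -eAU !inE xA1.
  by do ![case: (x \in _)].
have [E|N] := eqVneq (B :&: A') set0; have [E'|N'] := eqVneq (B :&: B') set0.
- have [b bB] := sepB h; have := sepD h b; have := sepD h' b.
  move/setP/(_ b): E; move/setP/(_ b): E'; rewrite -eAU !inE bB.
  by do ![case: (b \in _)].
- have := other _ _ h' E; have := half _ _ (sepC h') N'; lia.
- have := other _ _ (sepC h') E'; have := half _ _ h' N; lia.
- have := half _ _ h' N; have := half _ _ (sepC h') N'; lia.
Qed.

Lemma corner_of_nsub A X B A' U B' : big_sep A X B -> sep A' U B' -> #|U| = kappa e ->
  A :&: A' = set0 -> A :&: B' != set0.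
Proof.
move=> h h' cU E; apply/negP => /eqP E'; have [hs _ _ _] := h.
case/negP: (big_not_sub h h' cU); apply/subsetP => v vA.
move/setP/(_ v): E; move/setP/(_ v): E'; have := sepD h' v; rewrite !inE vA.
by do ![case: (v \in _)].
Qed.

End Separations.

(** * Crossing minimum cuts *)

Section Crossing.
Variables (V : finType) (e : rel V).
Hypothesis esym : symmetric e.
Implicit Types A B D U X Z : {set V}.

(* The corner bounds leave a single region that [A] and [B] can meet, so the
   other two lie in [X]. *)
Lemma three_regions A X B U D1 D2 D3 :
  big_sep e A X B -> #|U| = kappa e ->
  sep e D1 U (D2 :|: D3) -> sep e D2 U (D1 :|: D3) -> sep e D3 U (D1 :|: D2) ->
  X :&: D3 != set0 -> X :&: (D1 :|: D2) != set0 ->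
  D3 \subset X \/ D1 :|: D2 \subset X.
Proof.
move=> h cU h1 h2 h3 n3 n12; have [hs cX _ _] := h.
have h' := big_sepC esym h; have hs' := sepC esym hs.
have n12' : 0 < #|X :&: D1| + #|X :&: D2|.
  rewrite -card_gt0 in n12; apply: leq_trans n12 _.
  by rewrite setIUr leq_card_setU.
have n3' : 0 < #|X :&: D3| by rewrite card_gt0.
have cX3 : #|X| = #|X :&: D1| + #|X :&: D2| + #|X :&: D3| + #|X :&: U|.
  rewrite !card_indicator -!big_split; apply: eq_bigr => v _ /=; rewrite !inE.
  move: (sepD h1 v) (sepD h2 v); rewrite !inE.
  by case: (v \in D1); case: (v \in D2); case: (v \in D3); case: (v \in U);
     case: (v \in X).
have cUX := card_sep U hs; rewrite (setIC U X) in cUX.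
have sub D E : sep e D U E -> A :&: D = set0 -> B :&: D = set0 -> D \subset X /\ 0 < #|X :&: D|.
  move=> hD /setP EA /setP EB.
  have sDX : D \subset X.
    apply/subsetP=> v vD; have := EA v; have := EB v; rewrite !inE vD !andbT.
    by have := sepD hs v; do ![case: (v \in _)].
  by split=> //; move/setIidPr: (sDX) => ->; apply/card_gt0P; apply: sepA hD.
have cor A0 B0 D E : sep e A0 X B0 -> sep e D U E -> A0 :&: D != set0 ->
    kappa e <= #|X :&: D| + #|X :&: U| + #|U :&: A0|.
  by move=> ? ? /set0Pn[x]; rewrite inE => /andP[? ?]; apply: corner; eassumption.
have nA : ~ [/\ A :&: D1 = set0, A :&: D2 = set0 & A :&: D3 = set0].
  case=> E1 E2 E3; have := corner_of_nsub esym h h1 cU E1.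
  by rewrite setIUr E2 E3 setU0 eqxx.
have nB : ~ [/\ B :&: D1 = set0, B :&: D2 = set0 & B :&: D3 = set0].
  case=> E1 E2 E3; have := corner_of_nsub esym h' h1 cU E1.
  by rewrite setIUr E2 E3 setU0 eqxx.
(* If [A] meets one region and [B] another, the two corner bounds add up to [X] missing the third;
   if both meet the same region, [X] has at least as many vertices there as in the other two
   together. A region missed by [A] and [B] lies in [X] and is nonempty. [lia] discards the patterns
   that contradict this. *)
have [EA1|/(cor _ _ _ _ hs h1) NA1] := eqVneq (A :&: D1) set0;
have [EA2|/(cor _ _ _ _ hs h2) NA2] := eqVneq (A :&: D2) set0;
have [EA3|/(cor _ _ _ _ hs h3) NA3] := eqVneq (A :&: D3) set0;
have [EB1|/(cor _ _ _ _ hs' h1) NB1] := eqVneq (B :&: D1) set0;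
have [EB2|/(cor _ _ _ _ hs' h2) NB2] := eqVneq (B :&: D2) set0;
have [EB3|/(cor _ _ _ _ hs' h3) NB3] := eqVneq (B :&: D3) set0;
  try (by case: nA); try (by case: nB); try (exfalso; lia); try (by left; case: (sub _ _ h3));
  try (by case: (sub _ _ h1 EA1 EB1) => ? ?; exfalso; lia);
  try (by case: (sub _ _ h2 EA2 EB2) => ? ?; exfalso; lia);
  try (by case: (sub _ _ h1 EA1 EB1) => ? _; case: (sub _ _ h2 EA2 EB2) => ? _;
     right; rewrite subUset; apply/andP).
Qed.

(** A second component inside [A'] would split the complement of [U] into three regions, and
    [three_regions] would put [A'] or [B'] inside [X]. *)
Lemma side_region A X B A' U B' x :
  big_sep e A X B -> sep e A' U B' -> #|U| = kappa e ->
  X :&: A' != set0 -> X :&: B' != set0 -> ~~ (A' \subset X) -> ~~ (B' \subset X) ->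
  x \in A' -> side e U x = A'.
Proof.
move=> h h' cU nA nB sA sB xA.
have xU : x \notin U by move: (sepD h' x); rewrite xA; case: (_ \in U).
have sS : side e U x \subset A'.
  apply/subsetP => y; rewrite inE => /andP[_ xy]; have := avoid_closed _ xA xy; apply => u v uA vU euv.
  have := sepE h' uA (y := v); rewrite euv.
  by move: (sepD h' v) vU; do ![case: (v \in _)] => //= _ _ /(_ isT).
apply/eqP; rewrite eqEsubset sS /=; apply/subsetP => y yA; apply/negPn/negP => yS.
pose D1 := side e U x; pose D2 := A' :\: D1.
have D1A v : v \in D1 -> v \in A' by apply: (subsetP sS).
have x1 : x \in D1 by apply: side_refl.
have y2 : y \in D2 by rewrite in_setD yS yA.
have D12 : D1 :|: D2 = A' by rewrite -(setID A' D1) /D2 (setIidPr sS).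
have e12 u v : u \in D1 -> v \in D2 -> e u v = false.
  move=> u1; rewrite in_setD => /andP[v1 vA]; apply/negP => euv; case/negP: v1.
  apply: side_closed u1 _ euv.
  by move: (sepD h' v); rewrite vA; case: (_ \in U).
have sD2 v : v \in D2 -> v \in A' by rewrite in_setD => /andP[].
have h1 : sep e D1 U (D2 :|: B').
  split; [by exists x|by exists y; rewrite inE y2| |].
    move=> v; have := sepD h' v; have := @D1A v; rewrite in_setU in_setD.
    by case: (v \in D1) => [/(_ isT) ->|_]; do ![case: (v \in _)].
  by move=> u v u1; rewrite in_setU => /orP[/(e12 _ _ u1)|/(sepE h' (D1A _ u1))].
have h2 : sep e D2 U (D1 :|: B').
  split; [by exists y|by exists x; rewrite inE x1| |].
    move=> v; have := sepD h' v; have := @D1A v; rewrite in_setU in_setD.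
    by case: (v \in D1) => [/(_ isT) ->|_]; do ![case: (v \in _)].
  move=> u v u1; rewrite in_setU => /orP[v1|/(sepE h' (sD2 _ u1))//].
  by rewrite esym e12.
have h3 : sep e B' U (D1 :|: D2) by rewrite D12; apply: sepC.
have := three_regions h cU h1 h2 h3 nB; rewrite D12 => /(_ nA) [H|H].
  by rewrite H in sB.
by rewrite H in sA.
Qed.

Lemma sides_two A X B A' U B' :
  big_sep e A X B -> sep e A' U B' -> #|U| = kappa e ->
  X :&: A' != set0 -> X :&: B' != set0 -> ~~ (A' \subset X) -> ~~ (B' \subset X) ->
  sides e U = [set A'; B'].
Proof.
move=> h h' cU nA nB sA sB; have h'' := sepC esym h'.
apply/setP => D; rewrite !inE; apply/imsetP/orP.
  case=> x; rewrite inE => xU ->; have := sepD h' x; rewrite (negbTE xU) addn0.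
  case xA: (x \in A'); first by rewrite (side_region h h' cU nA nB sA sB xA); left.
  case xB: (x \in B') => // _; right.
  by rewrite (side_region h h'' cU nB nA sB sA xB).
case=> /eqP ->.
  have [x xA] := sepA h'; exists x; last by rewrite (side_region h h' cU nA nB sA sB xA).
  by move: (sepD h' x); rewrite inE xA; case: (_ \in U).
have [x xA] := sepB h'; exists x; last by rewrite (side_region h h'' cU nB nA sB sA xA).
by move: (sepD h' x); rewrite inE xA; do ![case: (x \in _)].
Qed.

(** The bounds at the corners [B :&: A'] and [A :&: B'] give [#|X :&: A'| = #|U :&: A|], so
    replacing [U :&: A] by [X :&: A'] in [U] keeps the size kappa. The new set [W] cuts off
    [A' :\: W], which lies in [B] because the corner [A :&: A'] is empty. *)
Lemma empty_corner_matching A X B A' U B' :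
  big_sep e A X B -> sep e A' U B' -> #|U| = kappa e ->
  X :&: A' != set0 -> X :&: B' != set0 -> ~~ (A' \subset X) -> ~~ (B' \subset X) ->
  A :&: A' = set0 -> crossing_matching_cut e U A' (U :&: A) X.
Proof.
move=> h h' cU nA nB sA sB E; have [hs cX _ _] := h.
have sU := sides_two h h' cU nA nB sA sB.
have hs' := sepC esym hs; have h'' := sepC esym h'.
have memE v : v \in A' -> v \in A = false.
  by move=> vA'; move/setP/(_ v): E; rewrite !inE vA' andbT.
have [x xA' xX] : exists2 x, x \in A' & x \notin X by apply/subsetPn.
have xB : x \in B by move: (sepD hs x); rewrite (negbTE xX) (memE _ xA'); case: (x \in B).
have /set0Pn[y] := corner_of_nsub esym h h' cU E; rewrite inE => /andP[yA yB'].
have k1 := corner hs' h' xB xA'; have k2 := corner hs h'' yA yB'.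
have cX' := card_sep X h'; have cU' := card_sep U hs.
rewrite (setIC U X) in cU'.
have eqc : #|X :&: A'| = #|U :&: A| by lia.
set P := U :&: A; pose W := (U :\: P) :|: (X :&: A').
have cW : #|W| = kappa e.
  rewrite -cU [RHS](card_sep U hs) [#|W|](card_sep W h') -eqc.
  have -> : W :&: A' = X :&: A'.
    by apply/setP=> v; rewrite !inE; move: (sepD h' v); do ![case: (v \in _)].
  have -> : W :&: B' = set0.
    by apply/setP=> v; rewrite !inE; move: (sepD h' v); do ![case: (v \in _)].
  have -> : W :&: U = U :&: X :|: U :&: B.
    apply/setP=> v; rewrite !inE; move: (sepD h' v) (sepD hs v).
    by do ![case: (v \in _)].
  rewrite cardsU; have -> : U :&: X :&: (U :&: B) = set0.
    by apply/setP=> v; rewrite !inE; move: (sepD hs v); do ![case: (v \in _)].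
  by rewrite !cards0; lia.
have hW : sep e (A' :\: W) W (P :|: B').
  split.
  - exists x; rewrite !inE xA' (negbTE xX); move: (sepD h' x); rewrite xA'.
    by do ![case: (x \in _)].
  - by exists y; rewrite !inE yB' orbT.
  - move=> v; rewrite !inE; have := memE v; move: (sepD h' v) (sepD hs v).
    by do ![case: (v \in _)] => //= _ _ /(_ isT).
  move=> u v; rewrite !inE => /andP[uW uA']; have uX : u \in X = false.
    by apply/negbTE; move: uW; rewrite uA'; do ![case: (u \in _)].
  have uB : u \in B by move: (sepD hs u); rewrite uX (memE _ uA'); case: (u \in B).
  by move=> /orP[/andP[_ vA]|/(sepE h' uA')//]; exact: (sepE hs' uB vA).
have kW := kcut_sep hW cW.
exists B'; split=> //; split; [|split; [|split; [|split; [|split]]]].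
- by apply/eqP => eAB; have := sepD h' x; rewrite -eAB xA'; case: (x \in U).
- by rewrite -card_gt0 -eqc card_gt0.
- by apply: subsetIl.
- by apply: kcut_sep hs cX.
- by [].
have R : ~: (U :|: A') = B'.
  by apply/setP=> v; rewrite !inE; move: (sepD h' v); do ![case: (v \in _)].
rewrite /matching_cut sU R -/W kW !inE eqxx /= subsetIl subsetUl /=; apply/and5P; split.
- by apply/subsetP=> v; rewrite !inE; do ![case: (v \in _)].
- by apply/set0Pn; apply: sepA hW.
- rewrite disjoint_subset; apply/subsetP => v vP; rewrite inE.
  by move: (sepD hW v); rewrite vP; do ![case: (v \in _)].
- by rewrite disjoint_subset; apply/subsetP => v; rewrite inE => /andP[].
apply/forall_inP=> u uP; apply/forall_inP=> v vA.
exact: sep_nconnect (sepC esym hW) uP vA.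
Qed.

(** When no corner is empty, each corner bound reads as inequalities between arms, and the four
    together make all arms equal. Only the two corners inside [A'] are recorded: later [A'] is a
    sector or a double sector. *)
Lemma crossing_dichotomy A X B A' U B' :
  big_sep e A X B -> sep e A' U B' -> #|U| = kappa e ->
  X :&: A' != set0 -> X :&: B' != set0 -> ~~ (A' \subset X) -> ~~ (B' \subset X) ->
  (exists D P, crossing_matching_cut e U D P X) \/
  [/\ A :&: A' != set0, B :&: A' != set0,
      #|X :&: B'| = #|X :&: A'|, #|U :&: A| = #|X :&: A'| & #|U :&: B| = #|X :&: A'|].
Proof.
move=> h h' cU nA nB sA sB; have [hs cX _ _] := h.
have hC := big_sepC esym h; have h'' := sepC esym h'; have hs' := sepC esym hs.
have cor A0 B0 D E : sep e A0 X B0 -> sep e D U E -> A0 :&: D != set0 ->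
    kappa e <= #|X :&: D| + #|X :&: U| + #|U :&: A0|.
  by move=> ? ? /set0Pn[x]; rewrite inE => /andP[? ?]; apply: corner; eassumption.
have [E|N1] := eqVneq (A :&: A') set0.
  by left; exists A', (U :&: A); apply: (empty_corner_matching h h').
have [E|N2] := eqVneq (B :&: A') set0.
  by left; exists A', (U :&: B); apply: (empty_corner_matching hC h').
have [E|N3] := eqVneq (A :&: B') set0.
  by left; exists B', (U :&: A); apply: (empty_corner_matching h h'').
have [E|N4] := eqVneq (B :&: B') set0.
  by left; exists B', (U :&: B); apply: (empty_corner_matching hC h'').
right; have cX' := card_sep X h'; have cU' := card_sep U hs.
rewrite (setIC U X) in cU'.
have := cor _ _ _ _ hs h' N1; have := cor _ _ _ _ hs' h' N2.
have := cor _ _ _ _ hs h'' N3; have := cor _ _ _ _ hs' h'' N4.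
by split=> //; lia.
Qed.

(** * Cuts that are not small *)

Lemma sides_trivIset U (Q : pred {set V}) : trivIset [set D in sides e U | Q D].
Proof.
apply/trivIsetP => D E; rewrite !inE => /andP[/imsetP[x xU ->] _] /andP[/imsetP[y yU ->] _].
apply: contraR; rewrite disjoint_subset => /subsetPn[z]; rewrite !inE negbK.
move=> /andP[zU xz] /andP[_ yz]; apply/eqP/setP=> t; rewrite !inE.
have sc := sym_connect_sym (avoid_sym esym U).
by rewrite (same_connect sc xz) (same_connect sc yz).
Qed.

Lemma not_small_big_sep X : 4 * kappa e < #|V| -> kcut e X ->
  small_cut e (kappa e - 1) X \/ exists A B, big_sep e A X B.
Proof.
move=> big /andP[cutX /eqP cX].
have [/exists_inP[A0 A0s leA]|] := boolP [exists A0 in sides e X,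
   \sum_(A in sides e X | A != A0) #|A| <= kappa e - 1]; first by left; exists A0.
rewrite negb_exists_in => /forall_inP ns; right.
have [x0 x0X hx0] := cut_sep cutX.
have finish A : kappa e <= #|A| -> kappa e <= #|~: (A :|: X)| -> [disjoint A & X] ->
    A != set0 -> ~: (A :|: X) != set0 ->
    (forall u v, u \in A -> v \notin X -> e u v -> v \in A) -> exists A B, big_sep e A X B.
  by move=> *; exists A, (~: (A :|: X)); split=> //; apply: sep_compl.
have compl A : #|~: (A :|: X)| + #|A| + #|X| >= #|V|.
  by have [? _] := leq_card_setU A X; have := cardsC (A :|: X); lia.
(* First case: one side has at least kappa vertices. As the cut is not small, the other sides
   together have at least kappa as well. *)
have [/exists_inP[x xX kx]|] := boolP [exists x in ~: X, kappa e <= #|side e X x|].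
  rewrite inE in xX.
  have sx : side e X x \in sides e X by apply/imsetP; exists x; rewrite // inE.
  have k2 : kappa e - 1 < #|~: (side e X x :|: X)|.
    have := ns _ sx; rewrite -ltnNge => /leq_trans; apply.
    have /eqP tr := sides_trivIset X (fun D => D != side e X x).
    have -> : \sum_(D in sides e X | D != side e X x) #|D| =
        \sum_(D in [set D in sides e X | D != side e X x]) #|D|.
      by apply: eq_bigl => D; rewrite inE.
    rewrite tr; apply: subset_leq_card; apply/bigcupsP => D; rewrite inE => /andP[Ds Dn].
    have /trivIsetP tr0 := sides_trivIset X predT.
    have dD : [disjoint D & side e X x] by apply: tr0 => //; rewrite inE ?Ds ?sx.
    have [y yX eD] := imsetP Ds; rewrite inE in yX.
    apply/subsetP => v vD; rewrite in_setC in_setU (disjointFr dD vD) /=.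
    by move: vD; rewrite eD inE => /andP[].
  apply: (finish (side e X x)) => //; [lia|exact: side_disjoint| | |].
  - by apply/set0Pn; exists x; apply: side_refl.
  - by rewrite -card_gt0; lia.
  - by move=> u v; apply: side_closed.
rewrite negb_exists_in => /forall_inP ssm.
have k0 : 0 < kappa e.
  by have := ssm x0; rewrite inE x0X => /(_ isT); rewrite -ltnNge; apply: leq_trans.
(* Second case: every side has fewer than kappa vertices. [clo] describes unions of sides with at
   least kappa vertices in total. A smallest one drops below kappa when a side is removed, so it has
   fewer than twice kappa vertices, and [4 * kappa e < #|V|] leaves more than kappa vertices outside
   it and [X]. *)
pose clo (F : {set V}) := [&& [disjoint F & X], [forall u in F, forall v, (v \notin X) && e u v ==> (v \in F)]
   & kappa e <= #|F|].
have clo0 : clo (~: X).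
  apply/and3P; split; last by have := cardsC X; lia.
    by rewrite disjoint_subset; apply/subsetP => v; rewrite !inE.
  by apply/forall_inP => u _; apply/forallP => v; apply/implyP; rewrite inE => /andP[].
case: (arg_minnP (fun F : {set V} => #|F|) clo0) => F /and3P[dF /forall_inP cF kF] minF.
have cF' u v : u \in F -> v \notin X -> e u v -> v \in F.
  by move=> uF vX euv; have /forallP/(_ v)/implyP := cF _ uF; apply; rewrite vX.
have [x xF] : exists x, x \in F by apply/card_gt0P; lia.
have xX : x \notin X by rewrite (disjointFr dF).
have sF : side e X x \subset F.
  by apply/subsetP => y; rewrite inE => /andP[_ xy]; apply: (avoid_closed cF' xF xy).
have sm : #|side e X x| < kappa e by rewrite ltnNge; apply: ssm; rewrite inE.
have sx : 0 < #|side e X x| by apply/card_gt0P; exists x; apply: side_refl.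
have cD : #|F :\: side e X x| + #|side e X x| = #|F|.
  by rewrite cardsDS // subnK // subset_leq_card.
have lt2 : #|F :\: side e X x| < kappa e.
  rewrite ltnNge; apply/negP => kD.
  have : clo (F :\: side e X x).
    apply/and3P; split=> //.
      by apply: disjointWl dF; apply: subsetDl.
    apply/forall_inP => u; rewrite in_setD => /andP[us uF]; apply/forallP => v.
    apply/implyP => /andP[vX euv]; rewrite in_setD (cF' _ _ uF vX euv) andbT.
    apply: contra us => vs; apply: side_closed vs _ _; rewrite 1?esym //.
    by rewrite (disjointFr dF).
  by move/minF; lia.
have cc := compl F.
apply: (finish F) => //; try lia; by rewrite -card_gt0; lia.
Qed.

End Crossing.

(** * Minimum cuts against a wheel *)

Section WheelGeometry.
Variables (V : finType) (e : rel V).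
Hypothesis esym : symmetric e.
Variables (T : {set V}) (w : nat) (C S : nat -> {set V}).

Definition spokes i j := C i :|: T :|: C j.
Definition double_sector k := S k :|: C k.+1 :|: S k.+1.

(** The cyclic families are unrolled to functions on [nat] of period [w], so that successors and
    translates of an index need no wrap-around; distinctness of indices becomes incongruence modulo
    [w]. *)
Record wheel_fam : Prop := WheelFam {
  wf_w : 4 <= w;
  wf_C0 : forall k, exists v, v \in C k;
  wf_S0 : forall k, exists v, v \in S k;
  wf_Cper : forall k l, k = l %[mod w] -> C k = C l;
  wf_Sper : forall k l, k = l %[mod w] -> S k = S l;
  wf_CC : forall k l v, k != l %[mod w] -> v \in C k -> v \in C l = false;
  wf_SS : forall k l v, k != l %[mod w] -> v \in S k -> v \in S l = false;
  wf_CS : forall k l v, v \in C k -> v \in S l = false;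
  wf_TC : forall k v, v \in T -> v \in C k = false;
  wf_TS : forall k v, v \in T -> v \in S k = false;
  wf_cover : forall v, v \in T \/ exists k, v \in C k \/ v \in S k;
  wf_sep : forall k,
    sep e (double_sector k) (spokes k k.+2) (~: (double_sector k :|: spokes k k.+2));
  wf_card : forall k, #|spokes k k.+2| = kappa e }.

Hypothesis W : wheel_fam.
Implicit Types A B : {set V}.
Let w4 : 4 <= w := wf_w W.

Lemma offset_mod k m n : m < w -> n < w -> m != n -> m + k != n + k %[mod w].
Proof. by move=> mw nw; rewrite eqn_modDr !modn_small. Qed.

Lemma C_off k m n v : m < w -> n < w -> m != n -> v \in C (m + k) -> v \in C (n + k) = false.
Proof. by move=> mw nw mn; apply: (wf_CC W); apply: offset_mod. Qed.

Lemma S_off k m n v : m < w -> n < w -> m != n -> v \in S (m + k) -> v \in S (n + k) = false.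
Proof. by move=> mw nw mn; apply: (wf_SS W); apply: offset_mod. Qed.

Lemma SC k l v : v \in S k -> v \in C l = false.
Proof. by move=> vS; apply/negP => vC; have := wf_CS W k vC; rewrite vS. Qed.
Lemma ST k v : v \in S k -> v \in T = false.
Proof. by move=> vS; apply/negP => vT; have := wf_TS W k vT; rewrite vS. Qed.
Lemma CT k v : v \in C k -> v \in T = false.
Proof. by move=> vS; apply/negP => vT; have := wf_TC W k vT; rewrite vS. Qed.

Lemma sector_outside k l v : k != l %[mod w] -> v \in S l ->
  v \in ~: (S k :|: spokes k k.+1).
Proof.
move=> kl vl; have vk := wf_SS W _ vl; rewrite !inE vk ?(SC _ vl) ?(ST vl) //.
by rewrite eq_sym.
Qed.

Lemma spoke_outside k l v : k != l %[mod w] -> k.+1 != l %[mod w] -> v \in C l ->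
  v \in ~: (S k :|: spokes k k.+1).
Proof.
move=> kl kl1 vl; rewrite !inE (wf_CS W _ vl) (CT vl).
by rewrite !(wf_CC W _ vl) // eq_sym.
Qed.

(** An edge leaving [S k.+1] stays within the closed double sectors at [k] and at [k.+1]. Their
    common part is the closed sector: [C k] and [C k.+3] are disjoint because [w] is at least 4. *)
Lemma sepS_succ k : sep e (S k.+1) (spokes k.+1 k.+2) (~: (S k.+1 :|: spokes k.+1 k.+2)).
Proof.
apply: sep_compl.
- rewrite disjoint_subset; apply/subsetP => v vS.
  by rewrite !inE !(SC _ vS) (ST vS).
- by apply/set0Pn; apply: wf_S0 W _.
- have [v vS] := wf_S0 W k; apply/set0Pn; exists v; apply: sector_outside vS.
  by rewrite eq_sym; apply: (@offset_mod k 0 1); nlia.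
move=> u v uS; rewrite !inE => vU euv.
have uD : u \in double_sector k by rewrite !inE uS orbT.
have uD' : u \in double_sector k.+1 by rewrite !inE uS.
have := sepE (wf_sep W k) uD (y := v); have := sepE (wf_sep W k.+1) uD' (y := v).
rewrite euv !inE; move: vU; case vT : (v \in T); first by rewrite orbT.
rewrite !orbF /= !negb_or => /andP[v1 v2]; rewrite v1 v2.
case: (v \in S k.+1) => //=; rewrite ?andbT.
case v3: (v \in S k.+2) => /=.
  rewrite (SC _ v3); have -> : v \in S k = false by apply: (@S_off k 2 0) v3; nlia.
  by move=> _ /(_ isT).
case v4: (v \in C k.+3) => /=; last by move=> /(_ isT).
rewrite (wf_CS W _ v4); have -> : v \in C k = false by apply: (@C_off k 3 0) v4; nlia.
by move=> _ /(_ isT).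
Qed.

(** [w.-1 + k] stands for the predecessor of [k] on the cycle, without truncated subtraction. *)
Lemma pred_mod k : (w.-1 + k).+1 = k %[mod w].
Proof. by rewrite -addSn prednK ?modnDl //; nlia. Qed.

Lemma sepS k : sep e (S k) (spokes k k.+1) (~: (S k :|: spokes k k.+1)).
Proof.
have := sepS_succ (w.-1 + k); rewrite /spokes (wf_Sper W (pred_mod k)).
rewrite (wf_Cper W (pred_mod k)) (@wf_Cper W (w.-1 + k).+2 k.+1) //.
by apply/eqP; rewrite -addn1 -(addn1 k) eqn_modDr; apply/eqP/pred_mod.
Qed.

(** * Sizes of spokes, and neighbours in sectors *)

Lemma card_spokes_sum i j : i != j %[mod w] -> #|spokes i j| = #|C i| + #|T| + #|C j|.
Proof.
move=> ij; rewrite !card_indicator -!big_split; apply: eq_bigr => v _ /=; rewrite !inE.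
case vi: (v \in C i); first by rewrite (CT vi) (wf_CC W ij vi).
by case vT: (v \in T); rewrite //= (wf_TC W _ vT).
Qed.

(** The cuts [spokes l l.+2] have exactly kappa vertices and the cuts [spokes l l.+1] at least
    kappa. Comparing them shows that spoke sizes never increase from [k] to [k + 4], while two of
    the equalities give the spokes at [k] and [k + 4] the same size; hence all are equal. *)
Lemma card_C_succ k : #|C k| = #|C k.+1| /\ #|C k| + #|T| + #|C k| = kappa e.
Proof.
have E2 l : #|C l| + #|T| + #|C l.+2| = kappa e.
  rewrite -card_spokes_sum ?(wf_card W) //.
  by apply: (@offset_mod l 0 2); nlia.
have E1 l : kappa e <= #|C l| + #|T| + #|C l.+1|.
  rewrite -card_spokes_sum; last by apply: (@offset_mod l 0 1); nlia.
  exact: kappa_sep (sepS l).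
move: (E2 k) (E2 k.+1) (E2 k.+2) (E1 k) (E1 k.+1) (E1 k.+2) (E1 k.+3); nlia.
Qed.

Lemma card_C k l : #|C k| = #|C l|.
Proof.
have E n : #|C n| = #|C 0|.
  by elim: n => // n <-; case: (card_C_succ n).
by rewrite !E.
Qed.

Lemma card_spokes i j : i != j %[mod w] -> #|spokes i j| = kappa e.
Proof.
by move=> ij; rewrite card_spokes_sum // (card_C j i); case: (card_C_succ i).
Qed.

Lemma card_spokes1 k : #|spokes k k.+1| = kappa e.
Proof. by apply: card_spokes; apply: (@offset_mod k 0 1); nlia. Qed.

Lemma nbrT k u : u \in T -> exists2 x, x \in S k & e u x.
Proof.
by move=> uT; apply: (cut_neighbor esym (sepS k) (card_spokes1 k)); rewrite !inE uT orbT.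
Qed.

Lemma nbrC k u : u \in C k -> exists2 x, x \in S k & e u x.
Proof.
by move=> uT; apply: (cut_neighbor esym (sepS k) (card_spokes1 k)); rewrite !inE uT.
Qed.

Lemma nbrC_succ k u : u \in C k.+1 -> exists2 x, x \in S k & e u x.
Proof.
by move=> uT; apply: (cut_neighbor esym (sepS k) (card_spokes1 k)); rewrite !inE uT orbT.
Qed.

(** * A kappa-cut against the sectors *)

Section Cut.
Variable X : {set V}.

Section Pure.
Variables A B : {set V}.
Hypothesis hAB : sep e A X B.

(** With [nbrT], [nbrC] and [nbrC_succ], this makes a sector inside [A] keep [T] and its two
    adjacent spokes out of [B]. *)
Lemma pure_nbr k u : S k \subset A -> (exists2 x, x \in S k & e u x) -> u \in B = false.
Proof.
move=> /subsetP sA [x /sA xA]; rewrite esym => exu; apply/negP => uB.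
by rewrite (sepE hAB xA uB) in exu.
Qed.

Lemma pureT k u : S k \subset A -> u \in T -> u \in B = false.
Proof. by move=> sA uT; apply: (pure_nbr sA); apply: nbrT. Qed.
Lemma pureC k u : S k \subset A -> u \in C k -> u \in B = false.
Proof. by move=> sA uT; apply: (pure_nbr sA); apply: nbrC. Qed.
Lemma pureC_succ k u : S k \subset A -> u \in C k.+1 -> u \in B = false.
Proof. by move=> sA uT; apply: (pure_nbr sA); apply: nbrC_succ. Qed.

End Pure.

(** The configuration in which [X :&: S i] can be inserted as a new spoke between [C i] and
    [C i.+1]: it has the size of a spoke, and both halves of the sector are nonempty. *)
Definition split_at i (A B : {set V}) : Prop :=
  [/\ C i \subset A, C i.+1 \subset B, #|X :&: S i| = #|C i|, S i :&: A != set0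
    & S i :&: B != set0].

(** The second alternative of [crossing_dichotomy] for the cut around [S i]: the four arms have
    equal size. *)
Definition four_corners i (A B : {set V}) : Prop :=
  X :&: S i != set0 /\
  [/\ S i :&: A != set0, S i :&: B != set0,
      #|X :&: ~: (S i :|: spokes i i.+1)| = #|X :&: S i|,
      #|spokes i i.+1 :&: A| = #|X :&: S i| & #|spokes i i.+1 :&: B| = #|X :&: S i|].

Lemma four_cornersC i A B : four_corners i A B -> four_corners i B A.
Proof. by case=> ? []. Qed.

(** [G] stands for the conclusion of the theorem, and each hypothesis for one way to reach it, with
    indices in all of [nat]. [case5] describes a small wheel: disjoint sectors contained in [X] have
    at most kappa vertices in total. *)
Variable G : Prop.
Hypothesis case1 : forall i j, i != j %[mod w] -> X = spokes i j -> G.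
Hypothesis case2 : forall i, X \subset spokes i i.+1 :|: S i -> G.
Hypothesis case3 : forall i U D P, U = spokes i i.+1 \/ U = spokes i i.+2 ->
  crossing_matching_cut e U D P X -> G.
Hypothesis case5 : forall i, (forall k, i != k %[mod w] -> S k \subset X) -> G.

(** If [S k] meets both parts, the two corner bounds, with no arm of [X] inside the sector, add up
    to [X] containing all kappa vertices of [spokes k k.+1]; then [X] equals this cut. *)
Lemma pure_sector A B k : big_sep e A X B -> X :&: S k = set0 ->
  G \/ S k \subset A \/ S k \subset B.
Proof.
move=> [h cX _ _] XS0.
have mem v : v \in S k -> (v \in A) + (v \in B) = 1.
  move=> vS; move/setP/(_ v): XS0; rewrite !inE vS andbT => vX.
  by rewrite -(sepD h v) vX addn0.
have [sB|/subsetPn[a aS aB]] := boolP (S k \subset B); first by right; right.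
have [sA|/subsetPn[b bS bA]] := boolP (S k \subset A); first by right; left.
left; apply: (@case1 k k.+1); first by apply: (@offset_mod k 0 1); nlia.
have aA : a \in A by have := mem _ aS; rewrite (negbTE aB); case: (a \in A).
have bB : b \in B by have := mem _ bS; rewrite (negbTE bA); case: (b \in B).
have k1 := corner h (sepS k) aA aS; have k2 := corner (sepC esym h) (sepS k) bB bS.
rewrite XS0 cards0 add0n in k1 k2.
have := card_sep (spokes k k.+1) h; rewrite (setIC _ X) card_spokes1 => E.
have sub : #|X :&: spokes k k.+1| = kappa e by nlia.
have <- : X :&: spokes k k.+1 = X by apply/eqP; rewrite eqEcard subsetIl cX sub leqnn.
by apply/eqP; rewrite eqEcard subsetIr sub card_spokes1 leqnn.
Qed.

Lemma sector_type A B k : big_sep e A X B ->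
  [\/ G, X :&: S k = set0, S k \subset X | four_corners k A B].
Proof.
move=> h; have [E|N] := eqVneq (X :&: S k) set0; first by constructor 2.
have [E|NS] := boolP (S k \subset X); first by constructor 3.
set R := ~: (S k :|: spokes k k.+1).
have [E|NR] := eqVneq (X :&: R) set0.
  constructor 1; apply: (case2 (i := k)); apply/subsetP => v vX.
  by move/setP/(_ v): E; rewrite /R in_setI in_setC vX in_set0 setUC /= => /negbFE.
(* If [X] contains the whole exterior of the closed sector, it contains every other sector, and the
   wheel is small. *)
have [sR|nR] := boolP (R \subset X).
  constructor 1; apply: (case5 (i := k)) => l kl; apply/subsetP => v vS.
  by apply: (subsetP sR); apply: sector_outside vS.
have [[D [P cmc]]|[a b c d f]] := crossing_dichotomy esym h (sepS k) (card_spokes1 k) N NR NS nR.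
  by constructor 1; apply: case3 cmc; left.
by constructor 4; split=> //; split=> //; rewrite setIC.
Qed.

(** The dichotomy is applied to [spokes p p.+2]. The sector in [A] keeps [C p.+1] out of [B], so [B]
    misses the double sector and four nonempty corners are impossible. *)
Lemma adjacent_pure_full A B p : big_sep e A X B ->
  (S p \subset A /\ S p.+1 \subset X) \/ (S p \subset X /\ S p.+1 \subset A) ->
  G \/ X \subset double_sector p :|: spokes p p.+2.
Proof.
move=> h hp; have [hs cX _ _] := h.
set R := ~: (double_sector p :|: spokes p p.+2).
have [E|NR] := eqVneq (X :&: R) set0.
  right; apply/subsetP => v vX.
  by move/setP/(_ v): E; rewrite /R in_setI in_setC vX in_set0 /= => /negbFE.
left; have [sR|nR] := boolP (R \subset X).
  have far l : p != l %[mod w] -> p.+1 != l %[mod w] -> S l \subset X.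
    move=> pl pl1; apply: subset_trans sR; apply/subsetP => v vS.
    by rewrite !inE !(SC _ vS) (ST vS) !(wf_SS W _ vS) // eq_sym.
  case: hp => -[s1 s2].
    apply: (case5 (i := p)) => l pl; have [/eqP pl1|] := boolP (p.+1 == l %[mod w]).
      by rewrite -(wf_Sper W pl1).
    exact: far.
  apply: (case5 (i := p.+1)) => l pl; have [/eqP pl1|] := boolP (p == l %[mod w]).
    by rewrite -(wf_Sper W pl1).
  by move=> ?; apply: far.
have XA v : v \in X -> v \in A -> False.
  by have := sepD hs v; do ![case: (v \in _)].
have [x xS] := wf_S0 W p; have [y yS] := wf_S0 W p.+1.
have N : X :&: double_sector p != set0.
  case: hp => -[/subsetP s1 /subsetP s2]; apply/set0Pn.
    by exists y; rewrite !inE yS s2 ?orbT.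
  by exists x; rewrite !inE xS s1.
have NS : ~~ (double_sector p \subset X).
  apply/negP => /subsetP s.
  case: hp => -[/subsetP s1 /subsetP s2].
    by apply: (XA x) => //; [apply: s; rewrite !inE xS | apply: s1].
  by apply: (XA y) => //; [apply: s; rewrite !inE yS orbT | apply: s2].
have [[D [P cmc]]|[_ /set0Pn[b] + _ _ _]] :=
    crossing_dichotomy esym h (wf_sep W p) (wf_card W p) N NR NS nR.
  by apply: case3 cmc; right.
have nX v : v \in X -> v \in B = false.
  by have := sepD hs v; do ![case: (v \in _)].
have nA v : v \in A -> v \in B = false.
  by have := sepD hs v; do ![case: (v \in _)].
rewrite !inE => /andP[bB /orP[/orP[]|]] bS; exfalso; case: hp => -[s1 s2].
- by have := nA _ (subsetP s1 _ bS); rewrite bB.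
- by have := nX _ (subsetP s1 _ bS); rewrite bB.
- by have := pureC_succ hs s1 bS; rewrite bB.
- by have := pureC hs s2 bS; rewrite bB.
- by have := nX _ (subsetP s2 _ bS); rewrite bB.
- by have := nA _ (subsetP s2 _ bS); rewrite bB.
Qed.

(** * Walking around the cycle of sectors *)

Lemma switch (P : pred nat) m n : m < n -> P m -> ~~ P n ->
  exists k, [/\ m <= k < n, P k & ~~ P k.+1].
Proof.
move=> + Pm; elim: n => // n IH; rewrite ltnS leq_eqVlt => /orP[/eqP <-|mn] Pn.
  by exists m; rewrite leqnn ltnSn.
have [Pn'|Pn'] := boolP (P n); first by exists n; rewrite ltnW //= ltnSn.
by have [k [/andP[mk kn] Pk Pk1]] := IH mn Pn'; exists k; rewrite mk ltnS ltnW.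
Qed.

(** A larger representative of [q] lets [switch] walk around the cycle from [p] to [q]. *)
Lemma per_far p q : exists q', q' = q %[mod w] /\ p < q'.
Proof. by exists (p.+1 * w + q); rewrite modnMDl; split=> //; nia. Qed.

Lemma full_period A B : big_sep e A X B ->
  (forall k, X :&: S k = set0 \/ S k \subset X) -> G.
Proof.
move=> h ty; have [hs cX _ _] := h; have hs' := sepC esym hs.
pose a k := X :&: S k == set0.
have aper k l : k = l %[mod w] -> a k = a l by rewrite /a => /(wf_Sper W) ->.
(* If no sector meets [X], each lies in [A] or in [B] and both kinds occur. At a change from [A] to
   [B] and at one back, the spoke lies in neither part; together with [T] these two spokes make up
   [X]. *)
have [/existsP[q0 q0P]|] := boolP [exists k : 'I_w, ~~ a k]; last first.
  rewrite negb_exists => /forallP all_a.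
  have {}all_a k : X :&: S k = set0.
    have kw : k %% w < w by rewrite ltn_mod; nlia.
    by have := all_a (Ordinal kw); rewrite negbK (@aper _ k) /= ?modn_mod // => /eqP.
  have pure k := pure_sector h (all_a k).
  have notall A0 B0 : sep e A0 X B0 -> ~ (forall k, S k \subset A0).
    move=> h0 sub; have [b bB] := sepB h0.
    have [bT|[k [bC|bS]]] := wf_cover W b.
    - by have := pureT h0 (sub 0) bT; rewrite bB.
    - by have := pureC h0 (sub k) bC; rewrite bB.
    by have := sepD h0 b; rewrite (subsetP (sub k) _ bS) bB; case: (b \in X).
  pose inA k := S k \subset A.
  have inAper k l : k = l %[mod w] -> inA k = inA l by rewrite /inA => /(wf_Sper W) ->.
  have [/forallP f1|] := boolP [forall k : 'I_w, inA k].
    exfalso; apply: (notall A B hs) => k.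
    have kw : k %% w < w by rewrite ltn_mod; nlia.
    by have := f1 (Ordinal kw); rewrite (@inAper _ k) /= ?modn_mod.
  rewrite negb_forall => /existsP[q qn].
  have [/existsP[p pA]|] := boolP [exists k : 'I_w, inA k]; last first.
    rewrite negb_exists => /forallP f1.
    have [/forallP f2|] := boolP [forall k : 'I_w, S k \subset B].
      exfalso; apply: (notall B A hs') => k.
      have kw : k %% w < w by rewrite ltn_mod; nlia.
      by have := f2 (Ordinal kw); rewrite (@wf_Sper W _ k) /= ?modn_mod.
    rewrite negb_forall => /existsP[r rn].
    by case: (pure r) => // -[H|H]; [have := f1 r; rewrite /inA H|rewrite H in rn].
  have inB k : ~~ inA k -> G \/ S k \subset B.
    by move=> nk; case: (pure k) => [|[H|]]; [left|move: nk; rewrite /inA H|right].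
  have [q' [eq pq]] := per_far p q.
  have [k [/andP[pk kq] kA kB]] := switch pq pA (etrans (congr1 negb (inAper _ _ eq)) qn).
  have [p' [ep kp]] := per_far k.+1 p.
  have pA' : ~~ ~~ inA p' by rewrite negbK (inAper _ _ ep).
  have [l [_ lB lA]] := switch (P := fun k => ~~ inA k) kp kB pA'.
  rewrite /= negbK in lA.
  case: (inB _ kB) => // {}kB'; case: (inB _ lB) => // {}lB'.
  have inX v : v \in A = false -> v \in B = false -> v \in X.
    by move=> vA vB; have := sepD hs v; rewrite vA vB addn0; case: (v \in X).
  have sub : spokes k.+1 l.+1 \subset X.
    apply/subsetP => v; rewrite !inE => /orP[/orP[]|] vv; apply: inX.
    - exact: (pureC hs' kB' vv).
    - exact: (pureC_succ hs kA vv).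
    - exact: (pureT hs' kB' vv).
    - exact: (pureT hs kA vv).
    - exact: (pureC_succ hs' lB' vv).
    - exact: (pureC hs lA vv).
  have kl : k.+1 != l.+1 %[mod w].
    apply/negP; rewrite -addn1 -(addn1 l) eqn_modDr => /eqP /inAper.
    by rewrite kA (negbTE lB).
  apply: (case1 kl); by apply/eqP; rewrite eq_sym eqEcard sub cX card_spokes ?leqnn.
have [/existsP[p pa]|] := boolP [exists k : 'I_w, a k]; last first.
  rewrite negb_exists => /forallP all_b; apply: (case5 (i := 0)) => k _.
  have kw : k %% w < w by rewrite ltn_mod; nlia.
  case: (ty k) => // E; have := all_b (Ordinal kw).
  by rewrite (@aper _ k) /= ?modn_mod // /a E eqxx.
(* Some sector misses [X] and some sector is contained in it; take neighbours [k], [k.+1] of these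
   kinds. [X] is confined to the closed double sector at [k], hence misses [S k.+2], and so is
   confined to the one at [k.+1] too. The two have only the closed sector of [S k.+1] in common. *)
have [q [eq pq]] := per_far p q0.
have [k [_ ka kb]] := switch pq pa (etrans (congr1 negb (aper _ _ eq)) q0P).
have kbX : S k.+1 \subset X by case: (ty k.+1) => // E; rewrite /a E eqxx in kb.
have pure1 A0 B0 : big_sep e A0 X B0 -> S k \subset A0 -> G \/ X \subset double_sector k :|: spokes k k.+2.
  by move=> h0 s0; apply: (adjacent_pure_full h0); left.
have h' := big_sepC esym h.
have [//|s1] : G \/ X \subset double_sector k :|: spokes k k.+2.
  case: (pure_sector h (eqP ka)) => [|[s|s]]; [by left|exact: (pure1 _ _ h s)|exact: (pure1 _ _ h' s)].
have a2 : X :&: S k.+2 = set0.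
  apply/setP => v; rewrite !inE; apply/negP => /andP[vX vS].
  have := subsetP s1 _ vX; rewrite !inE !(SC _ vS) (ST vS).
  have -> : v \in S k = false by apply: (@S_off k 2 0) vS; nlia.
  by have -> : v \in S k.+1 = false by apply: (@S_off k 2 1) vS; nlia.
have pure2 A0 B0 : big_sep e A0 X B0 -> S k.+2 \subset A0 ->
    G \/ X \subset double_sector k.+1 :|: spokes k.+1 k.+3.
  by move=> h0 s0; apply: (adjacent_pure_full h0); right.
have [//|s2] : G \/ X \subset double_sector k.+1 :|: spokes k.+1 k.+3.
  case: (pure_sector h a2) => [|[s|s]]; [by left|exact: (pure2 _ _ h s)|exact: (pure2 _ _ h' s)].
apply: (case2 (i := k.+1)); apply/subsetP => v vX.
have := subsetP s1 _ vX; have := subsetP s2 _ vX; rewrite !inE.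
case v3 : (v \in C k.+3).
  rewrite !(wf_CS W _ v3) (CT v3).
  have -> : v \in C k = false by apply: (@C_off k 3 0) v3; nlia.
  have -> : v \in C k.+1 = false by apply: (@C_off k 3 1) v3; nlia.
  by have -> : v \in C k.+2 = false by apply: (@C_off k 3 2) v3; nlia.
have v2 : v \in S k.+2 = false by move/setP/(_ v): a2; rewrite !inE vX.
by rewrite v2; do ![case: (v \in _)].
Qed.

(** The equal arms of both crossings show that outside either closed sector [X] lies in the other
    crossed sector. The sectors following [S (d + i)] up to the one before [S i] then all lie in
    [A], which puts [C i] and [C (d + i).+1] in [A]. By size, the arms in [B] are exactly [C i.+1]
    and [C (d + i)]. *)
Lemma two_split_pure A B i d : big_sep e A X B -> 0 < d -> d.+1 < w ->
  four_corners i A B -> four_corners (d + i) A B -> S (w.-1 + i) \subset A ->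
  G \/ [/\ split_at i A B, split_at (d + i) B A
         & X \subset S i :|: T :|: S (d + i)].
Proof.
move=> h d0 dw [_ [a1 a2 a3 a4 a5]] [_ [b1 b2 b3 b4 b5]] sA.
have [hs cX _ _] := h; have hs' := sepC esym hs.
have ij : i != d + i %[mod w] by apply: (@offset_mod i 0 d); nlia.
have ji : d + i != i %[mod w] by rewrite eq_sym.
have s1 : X :&: S (d + i) \subset X :&: ~: (S i :|: spokes i i.+1).
  by apply/setIS/subsetP => v; apply: sector_outside.
have s2 : X :&: S i \subset X :&: ~: (S (d + i) :|: spokes (d + i) (d + i).+1).
  by apply/setIS/subsetP => v; apply: sector_outside.
have c1 := subset_leq_card s1; have c2 := subset_leq_card s2; rewrite a3 in c1; rewrite b3 in c2.
have E1 : X :&: ~: (S i :|: spokes i i.+1) = X :&: S (d + i).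
  by apply/eqP; rewrite eq_sym eqEcard s1 a3.
have E2 : X :&: ~: (S (d + i) :|: spokes (d + i) (d + i).+1) = X :&: S i.
  by apply/eqP; rewrite eq_sym eqEcard s2 b3.
have XS m : 0 < m < w -> m != d -> X :&: S (m + i) = set0.
  move=> /andP[m0 mw] md; apply/setP => v; rewrite !inE; apply/negP => /andP[vX vS].
  have : v \in X :&: ~: (S i :|: spokes i i.+1).
    by rewrite in_setI vX; apply: sector_outside vS; apply: (@offset_mod i 0 m); nlia.
  rewrite E1 inE; have -> : v \in S (d + i) = false by apply: (@S_off i m d) vS; nlia.
  by rewrite andbF.
have XC1 m v : 1 < m < w -> v \in C (m + i) -> v \in X = false.
  move=> /andP[m1 mw] vC; apply/negP => vX.
  have : v \in X :&: ~: (S i :|: spokes i i.+1).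
    by rewrite in_setI vX; apply: spoke_outside vC;
      [apply: (@offset_mod i 0 m)|apply: (@offset_mod i 1 m)]; nlia.
  by rewrite E1 inE (wf_CS W _ vC) andbF.
have XCi v : v \in C i -> v \in X = false.
  move=> vC; apply/negP => vX.
  have : v \in X :&: ~: (S (d + i) :|: spokes (d + i) (d + i).+1).
    by rewrite in_setI vX; apply: spoke_outside vC;
      [apply: (@offset_mod i d 0)|apply: (@offset_mod i d.+1 0)]; nlia.
  by rewrite E2 inE (wf_CS W _ vC) andbF.
have inA v : v \in X = false -> v \in B = false -> v \in A.
  by move=> vX vB; have := sepD hs v; rewrite vX vB !addn0; case: (v \in A).
(* The induction walks backwards from the sector before [S i]: the spoke between consecutive sectors
   avoids [X] and [B], so it carries [A] to the preceding sector. *)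
have arc n : n < w.-1 - d -> G \/ S (w.-1 - n + i) \subset A.
  elim: n => [|n IH] nd; first by rewrite subn0; right.
  have [|g|sn] := IH; [nlia|by left|].
  have [v vC] := wf_C0 W (w.-1 - n + i).
  have eqn : w.-1 - n + i = (w.-1 - n.+1 + i).+1 by nlia.
  have vA : v \in A.
    by apply: inA; [apply: (XC1 (w.-1 - n)) vC; nlia|exact: (pureC hs sn vC)].
  have E : X :&: S (w.-1 - n.+1 + i) = set0 by apply: XS; nlia.
  case: (pure_sector h E) => [g|[s|sB]]; [by left|by right|].
  by rewrite eqn in vC; have := pureC_succ hs' sB vC; rewrite vA.
have [|g|sA1] := arc (w.-1 - d.+1); [nlia|by left|].
have {}sA1 : S (d.+1 + i) \subset A by have <- : w.-1 - (w.-1 - d.+1) = d.+1 by nlia.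
have eqi := pred_mod i.
have CiA : C i \subset A.
  apply/subsetP => v vC; apply: inA; first exact: XCi.
  by rewrite -(wf_Cper W eqi) in vC; exact: (pureC_succ hs sA vC).
have CjA : C (d + i).+1 \subset A.
  apply/subsetP => v vC; apply: inA; first by apply: (XC1 d.+1) vC; nlia.
  exact: (pureC hs sA1 vC).
have TB v : v \in T -> v \in B = false := pureT hs sA (u := v).
have nAB v : v \in A -> v \in B = false.
  by have := sepD hs v; do ![case: (v \in _)].
have CiU : C i \subset spokes i i.+1 :&: A.
  by rewrite subsetI CiA andbT; apply/subsetP => v; rewrite !inE => ->.
have BU : spokes i i.+1 :&: B \subset C i.+1.
  apply/subsetP => v; rewrite !inE => /andP[/orP[/orP[vC|vT]|//] vB].
    by have := nAB _ (subsetP CiA _ vC); rewrite vB.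
  by rewrite TB in vB.
have k1 := subset_leq_card CiU; have k2 := subset_leq_card BU.
have k3 := card_C i i.+1; have k4 := card_C i (d + i).
have es : #|X :&: S i| = #|C i| by nlia.
have eB : spokes i i.+1 :&: B = C i.+1 by apply/eqP; rewrite eqEcard BU a5 es k3 leqnn.
have Ci1B : C i.+1 \subset B by rewrite -eB subsetIr.
have BU' : spokes (d + i) (d + i).+1 :&: B \subset C (d + i).
  apply/subsetP => v; rewrite !inE => /andP[/orP[/orP[//|vT]|vC] vB].
    by rewrite TB in vB.
  by have := nAB _ (subsetP CjA _ vC); rewrite vB.
have eB' : spokes (d + i) (d + i).+1 :&: B = C (d + i).
  by apply/eqP; rewrite eqEcard BU' b5; nlia.
right; split=> //.
- split=> //; last by nlia.
  by rewrite -eB' subsetIr.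
apply/subsetP => v vX; rewrite !inE.
case vS: (v \in S i) => //=; case vT: (v \in T) => //=.
have : v \in X :&: S (d + i); last by rewrite inE => /andP[].
rewrite -E1 !inE vX vS vT /= orbF negb_or; apply/andP; split.
  by apply/negP => /XCi; rewrite vX.
apply/negP => /(subsetP Ci1B) vB.
by have := sepD hs v; rewrite vX vB; case: (v \in A).
Qed.

(** The arm of [spokes i i.+1] in [B] lies in [C i.+1] and forces [S i.+1] into [B]. Before [S i] is
    reached again, a sector in [B] is followed by one in [A], and the spoke between them lies in
    [X]. Having the size of a spoke, it fills the arm of [X] outside the closed sector. *)
Lemma one_split_pure A B i : big_sep e A X B -> four_corners i A B ->
  (forall m, 0 < m < w -> X :&: S (m + i) = set0) -> S (w.-1 + i) \subset A ->
  G \/ exists2 m, 1 < m < w &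
    split_at i A B /\ X \subset S i :|: T :|: C (m + i).
Proof.
move=> h [a0 [a1 a2 a3 a4 a5]] XS sA.
have [hs cX _ _] := h; have hs' := sepC esym hs.
have TB v : v \in T -> v \in B = false := pureT hs sA (u := v).
have CiB v : v \in C i -> v \in B = false.
  by rewrite -(wf_Cper W (pred_mod i)); exact: (pureC_succ hs sA).
have BU : spokes i i.+1 :&: B \subset C i.+1.
  apply/subsetP => v; rewrite !inE => /andP[/orP[/orP[vC|vT]|//] vB].
    by rewrite CiB in vB.
  by rewrite TB in vB.
rewrite -card_gt0 -a5 in a0; have [v] := card_gt0P a0 => vUB.
have vC := subsetP BU _ vUB; move: vUB; rewrite inE => /andP[_ vB].
have sB : G \/ S i.+1 \subset B.
  have E1 : X :&: S i.+1 = set0 by apply: (XS 1); nlia.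
  case: (pure_sector h E1) => [g|[s|s]]; [by left| |by right].
  by have := pureC hs s vC; rewrite vB.
case: sB => [g|sB]; first by left.
have TA u : u \in T -> u \in A = false := pureT hs' sB (u := u).
have CiA u : u \in C i.+1 -> u \in A = false := pureC hs' sB (u := u).
have inX u : u \in A = false -> u \in B = false -> u \in X.
  by move=> uA uB; have := sepD hs u; rewrite uA uB addn0; case: (u \in X).
have AU : spokes i i.+1 :&: A \subset C i.
  apply/subsetP => u; rewrite !inE => /andP[/orP[/orP[//|uT]|uC] uA].
    by rewrite TA in uA.
  by rewrite CiA in uA.
have nsB : ~~ (S (w.-1 + i) \subset B).
  apply/negP => /subsetP s; have [x xS] := wf_S0 W (w.-1 + i).
  by have := sepD hs x; rewrite (subsetP sA _ xS) (s _ xS); case: (x \in X).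
have lt1 : 1 < w.-1 by nlia.
have [m [/andP[m1 mw] mB mA]] := switch (P := fun m => S (m + i) \subset B) lt1 sB nsB.
have sA' : G \/ S (m.+1 + i) \subset A.
  have E1 : X :&: S (m.+1 + i) = set0 by apply: XS; nlia.
  by case: (pure_sector h E1) => [g|[s|s]]; [left|right|rewrite s in mA].
case: sA' => [g|sA']; first by left.
have CX : C (m.+1 + i) \subset X :&: ~: (S i :|: spokes i i.+1).
  apply/subsetP => u uC; rewrite in_setI; apply/andP; split.
    by apply: inX; [exact: (pureC_succ hs' mB uC)|exact: (pureC hs sA' uC)].
  by apply: spoke_outside uC; [apply: (@offset_mod i 0 m.+1)|apply: (@offset_mod i 1 m.+1)]; nlia.
have k1 := subset_leq_card CX; have k2 := subset_leq_card BU; have k3 := subset_leq_card AU.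
have k4 := card_C i i.+1; have k5 := card_C i (m.+1 + i).
have es : #|X :&: S i| = #|C i| by nlia.
have eA : spokes i i.+1 :&: A = C i by apply/eqP; rewrite eqEcard AU; nlia.
have eB : spokes i i.+1 :&: B = C i.+1 by apply/eqP; rewrite eqEcard BU; nlia.
have eX : C (m.+1 + i) = X :&: ~: (S i :|: spokes i i.+1).
  by apply/eqP; rewrite eqEcard CX; nlia.
right; exists m.+1; first nlia.
have CA : C i \subset A by rewrite -eA subsetIr.
have CB : C i.+1 \subset B by rewrite -eB subsetIr.
split=> //; apply/subsetP => u uX; rewrite in_setU.
case uS: (u \in S i); first by rewrite !inE uS.
case uT: (u \in T); first by rewrite !inE uT orbT.
rewrite eX !inE uX uS uT /= orbF negb_or; apply/andP; split; apply/negP => uC.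
  by have := sepD hs u; rewrite uX (subsetP CA _ uC).
by have := sepD hs u; rewrite uX (subsetP CB _ uC); case: (u \in A).
Qed.

Lemma wheel_cut_cases A B : big_sep e A X B ->
  [\/ G,
      exists i d A' B', [/\ 0 < d < w, sep e A' X B', split_at i A' B',
        split_at (d + i) B' A' & X \subset S i :|: T :|: S (d + i)]
    | exists i m A' B', [/\ 1 < m < w, sep e A' X B', split_at i A' B' &
         X \subset S i :|: T :|: C (m + i)]].
Proof.
move=> h; have h' := big_sepC esym h; have [hs cX _ _] := h; have hs' := sepC esym hs.
have w0 : 0 < w by nlia.
pose c k := (X :&: S k != set0) && ~~ (S k \subset X).
have cper k l : k = l %[mod w] -> c k = c l by rewrite /c => /(wf_Sper W) ->.
have notc k : ~~ c k -> X :&: S k = set0 \/ S k \subset X.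
  by rewrite negb_and !negbK => /orP[/eqP|]; [left|right].
have isc k : c k -> G \/ four_corners k A B.
  move=> /andP[c1 c2]; case: (sector_type k h) => [g|E|E|]; [by left| | |by right].
    by rewrite E eqxx in c1.
  by rewrite E in c2.
have [/existsP[i ci]|] := boolP [exists k : 'I_w, c k]; last first.
  rewrite negb_exists => /forallP all_n; constructor 1; apply: (full_period h) => k.
  have kw : k %% w < w by rewrite ltn_mod.
  by apply: notc; have := all_n (Ordinal kw); rewrite (@cper _ k) /= ?modn_mod.
case: (isc _ ci) => [g|fi]; first by constructor 1.
have two j d : 0 < d -> d.+1 < w -> c j -> c (d + j) -> G \/
   exists i d A' B', [/\ 0 < d < w, sep e A' X B', split_at i A' B',
        split_at (d + i) B' A' & X \subset S i :|: T :|: S (d + i)].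
  move=> d0 dw cj cdj; case: (isc _ cj) => [g|fj]; first by left.
  case: (isc _ cdj) => [g|fd]; first by left.
  (* By counting: the arm of [X] outside the closed sector of [S j] is already filled by
     [X :&: S (d + j)]. *)
  have Xz : X :&: S (w.-1 + j) = set0.
    have [_ [_ _ b1 _ _]] := fj; have [_ [_ _ b2 _ _]] := fd.
    apply/setP => v; rewrite !inE; apply/negP => /andP[vX vS].
    have dj : j != d + j %[mod w] by apply: (@offset_mod j 0 d); nlia.
    have s1 : v |: (X :&: S (d + j)) \subset X :&: ~: (S j :|: spokes j j.+1).
      rewrite subUset sub1set in_setI vX; apply/andP; split.
        by apply: sector_outside vS; apply: (@offset_mod j 0 w.-1); nlia.
      by apply/setIS/subsetP => u; apply: sector_outside.
    have s2 : X :&: S j \subset X :&: ~: (S (d + j) :|: spokes (d + j) (d + j).+1).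
      by apply/setIS/subsetP => u; apply: sector_outside; rewrite eq_sym.
    have := subset_leq_card s1; have := subset_leq_card s2.
    have vS' : v \in S (d + j) = false by apply: (@S_off j w.-1 d) vS; nlia.
    by rewrite cardsU1 in_setI vS' andbF; nlia.
  case: (pure_sector h Xz) => [g|[s|s]]; first by left.
    case: (two_split_pure h d0 dw fj fd s) => [g|[? ? ?]]; first by left.
    by right; exists j, d, A, B; split=> //; nlia.
  case: (two_split_pure h' d0 dw (four_cornersC fj) (four_cornersC fd) s) => [g|[? ? ?]]; first by left.
  by right; exists j, d, B, A; split=> //; nlia.
have one : (forall m, 0 < m < w -> X :&: S (m + i) = set0) -> G \/
    exists i m A' B', [/\ 1 < m < w, sep e A' X B', split_at i A' B' &
         X \subset S i :|: T :|: C (m + i)].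
  move=> XS; have Xz : X :&: S (w.-1 + i) = set0 by apply: XS; nlia.
  case: (pure_sector h Xz) => [g|[s|s]]; first by left.
    case: (one_split_pure h fi XS s) => [g|[m mw [? ?]]]; first by left.
    by right; exists i, m, A, B; split.
  case: (one_split_pure h' (four_cornersC fi) XS s) => [g|[m mw [? ?]]]; first by left.
  by right; exists i, m, B, A; split.
have [/existsP[d /andP[d0 cd]]|] := boolP [exists d : 'I_w, (0 < d) && c (d + i)].
  have [dw|dw] := ltnP d.+1 w.
    by case: (two i d d0 dw ci cd) => [g|H]; [constructor 1|constructor 2].
  (* Here [d] is [w.-1], so the second crossed sector precedes [S i]; the pair is taken from there,
     with offset 1. *)
  have := two (d + i) 1 isT; case=> //; [nlia| | by constructor 1|by constructor 2].
  rewrite (@cper _ i) //; have -> : 1 + (d + i) = w + i by have := ltn_ord d; nlia.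
  by rewrite modnDl.
rewrite negb_exists => /forallP none.
have ty m : 0 < m < w -> X :&: S (m + i) = set0 \/ S (m + i) \subset X.
  move=> /andP[m0 mw]; apply: notc; have := none (Ordinal mw).
  by rewrite /= m0.
pose a m := X :&: S (m + i) == set0.
(* A missed sector next to a contained one would confine [X] to a closed double sector away from
   [S i], which [X] meets; so only [G] remains. *)
have fin (m : nat) : 0 < m < w.-1 -> a m != a m.+1 -> G.
  move=> mw am.
  have tm : X :&: S (m + i) = set0 \/ S (m + i) \subset X by apply: ty; nlia.
  have tm1 : X :&: S (m.+1 + i) = set0 \/ S (m.+1 + i) \subset X by apply: ty; nlia.
  have [//|s] : G \/ X \subset double_sector (m + i) :|: spokes (m + i) (m + i).+2.
    case am1: (a m) am => /=; case am2: (a m.+1) => // _.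
      have {}tm1 : S (m.+1 + i) \subset X by case: tm1 => // E; rewrite /a E eqxx in am2.
      case: (pure_sector h (eqP am1)) => [g|[s|s]]; first by left.
        by apply: (adjacent_pure_full h); left.
      by apply: (adjacent_pure_full h'); left.
    have {}tm : S (m + i) \subset X by case: tm => // E; rewrite /a E eqxx in am1.
    case: (pure_sector h (eqP am2)) => [g|[s|s]]; first by left.
      by apply: (adjacent_pure_full h); right.
    by apply: (adjacent_pure_full h'); right.
  have [/set0Pn[v]] := fi; rewrite inE => /andP[vX vS] _; exfalso.
  have := subsetP s _ vX; rewrite !inE !(SC _ vS) (ST vS).
  have -> : v \in S (m + i) = false by apply: (@S_off i 0 m) vS; nlia.
  by have -> : v \in S (m + i).+1 = false by apply: (@S_off i 0 m.+1) vS; nlia.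
have [/forallP alla|] := boolP [forall m : 'I_w, (0 < m) ==> a m].
  case: one => [m /andP[m0 mw]||]; [|by constructor 1|by constructor 3].
  by have := alla (Ordinal mw); rewrite /= m0 => /eqP.
rewrite negb_forall => /existsP[q]; rewrite negb_imply => /andP[q0 qn]; constructor 1.
have [/existsP[p /andP[p0 pa]]|] := boolP [exists m : 'I_w, (0 < m) && a m]; last first.
  rewrite negb_exists => /forallP alln; apply: (case5 (i := i)) => k ik.
  (* The offset of [k] from [i] along the cycle. *)
  pose m := (k + (w - i)) %% w.
  have mw : m < w by rewrite ltn_mod.
  have iw := ltn_ord i.
  have mk : m + i = k %[mod w].
    by rewrite /m modnDml -addnA subnK ?modnDr // ltnW.
  have m0 : 0 < m.
    by rewrite lt0n; apply: contra ik => /eqP m0; rewrite -mk m0.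
  have := alln (Ordinal mw); rewrite /= m0 /= => nam.
  have m0w : 0 < m < w by rewrite m0.
  by case: (ty m m0w); rewrite (wf_Sper W mk) // => E; rewrite /a (wf_Sper W mk) E eqxx in nam.
have pw := ltn_ord p; have qw := ltn_ord q.
have [pq|qp|pq] := ltngtP p q.
- by have [k [kk ka kb]] := switch pq pa qn; apply: (fin k); [nlia|rewrite ka (negbTE kb)].
- have pa' : ~~ ~~ a p by rewrite negbK.
  have [k [kk ka kb]] := switch (P := fun k => ~~ a k) qp qn pa'.
  by rewrite /= negbK in kb; apply: (fin k); [nlia|rewrite kb (negbTE ka)].
- by rewrite -pq pa in qn.
Qed.

End Cut.
End WheelGeometry.

(** * Refining a wheel *)

Section Insertion.
Variables (V : finType) (e : rel V).
Hypothesis esym : symmetric e.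
Variable T : {set V}.

Section Halves.
Variables (w : nat) (C S : nat -> {set V}) (X A B : {set V}).
Hypotheses (W : wheel_fam e T w C S) (hAB : sep e A X B).
Let w4 : 4 <= w := wf_w W.

(** The wheel condition for the new spoke [X :&: S i] and [C i.+2]. Edges from [B] never reach [A],
    hence neither [C i] nor the half of [S i] in [A]; and [C i.+1] lies in [B]. *)
Lemma right_half_sep i : split_at C S X i A B ->
  let P := S i :&: B :|: C i.+1 :|: S i.+1 in let U := X :&: S i :|: T :|: C i.+2 in
  sep e P U (~: (P :|: U)) /\ #|U| = kappa e.
Proof.
move=> [CA CB eX nA nB] P U.
have d01 : i != i.+1 %[mod w] by apply: (offset_mod i (m := 0) (n := 1)); nlia.
have d12 : i.+1 != i.+2 %[mod w] by apply: (offset_mod i (m := 1) (n := 2)); nlia.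
have d02 : i != i.+2 %[mod w] by apply: (offset_mod i (m := 0) (n := 2)); nlia.
have nAB v : v \in A -> v \in B = false by have := sepD hAB v; do ![case: (v \in _)].
have nXB v : v \in X -> v \in B = false by have := sepD hAB v; do ![case: (v \in _)].
have eBA u v : u \in B -> e u v -> v \in A = false.
  by move=> uB euv; apply/negP => vA; have := sepE hAB vA uB; rewrite esym euv.
split; last first.
  have [E K] := card_C_succ W i; rewrite -K -{1}eX [in RHS](card_C W i i.+2).
  rewrite !card_indicator -!big_split; apply: eq_bigr => v _; rewrite !inE /=.
  case vS: (v \in S i); first by rewrite (ST W vS) (SC W _ vS) andbT !orbF !addn0.
  by case vT: (v \in T); rewrite andbF //= (wf_TC W _ vT).
apply: sep_compl.
- rewrite disjoint_subset; apply/subsetP => v; rewrite !inE => /orP[/orP[/andP[vS vB]|vC]|vS].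
  + rewrite (ST W vS) (SC W _ vS) !orbF; apply/negP => /andP[/nXB].
    by rewrite vB.
  + by rewrite (wf_CS W _ vC) (CT W vC) andbF (wf_CC W d12 vC).
  + by rewrite (ST W vS) (SC W _ vS) (wf_SS W _ vS) ?andbF // eq_sym.
- by have [v vC] := wf_C0 W i.+1; apply/set0Pn; exists v; rewrite !inE vC orbT.
- have [v vC] := wf_C0 W i; apply/set0Pn; exists v.
  by rewrite !inE !(wf_CS W _ vC) (CT W vC) !(wf_CC W _ vC) // andbF.
move=> u v + vU euv; move: vU; rewrite !inE !negb_or => /andP[/andP[vX vT] v2].
have nA' : u \in B -> v \in A = false by move/eBA; apply.
have memB : v \in S i -> u \in B -> v \in B.
  move=> vS /nA' vA; rewrite vS andbT in vX.
  by have := sepD hAB v; rewrite vA (negbTE vX); case: (v \in B).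
have nC : u \in B -> v \in C i = false.
  by move=> /nA' vA; apply/negP => /(subsetP CA); rewrite vA.
case/orP => [/orP[/andP[uS uB]|uC]|uS].
- have := sepE (sepS W i) uS (y := v); rewrite euv !inE (negbTE vT) (nC uB) /=.
  case vS: (v \in S i); first by rewrite memB.
  by case: (v \in C i.+1) => //= /(_ isT).
- have uD : u \in double_sector C S i by rewrite !inE uC orbT.
  have uB := subsetP CB _ uC.
  have := sepE (wf_sep W i) uD (y := v); rewrite euv !inE (negbTE vT) (negbTE v2) (nC uB) /=.
  case vS: (v \in S i); first by rewrite memB.
  case: (v \in C i.+1) => //=; case: (v \in S i.+1) => //= /(_ isT) //.
have := sepE (sepS W i.+1) uS (y := v); rewrite euv !inE (negbTE vT) (negbTE v2) /=.
case: (v \in C i.+1); first by rewrite orbT.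
by case: (v \in S i.+1); rewrite ?orbT // => /(_ isT).
Qed.

(** Mirror image of [right_half_sep]: the wheel condition for [C i] and the new spoke in
    [S i.+1]. *)
Lemma left_half_sep i : split_at C S X i.+1 A B ->
  let P := S i :|: C i.+1 :|: S i.+1 :&: A in let U := C i :|: T :|: X :&: S i.+1 in
  sep e P U (~: (P :|: U)) /\ #|U| = kappa e.
Proof.
move=> [CA CB eX nA nB] P U.
have d01 : i != i.+1 %[mod w] by apply: (offset_mod i (m := 0) (n := 1)); nlia.
have d12 : i.+1 != i.+2 %[mod w] by apply: (offset_mod i (m := 1) (n := 2)); nlia.
have d02 : i != i.+2 %[mod w] by apply: (offset_mod i (m := 0) (n := 2)); nlia.
have nXA v : v \in X -> v \in A = false by have := sepD hAB v; do ![case: (v \in _)].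
have eAB u v : u \in A -> e u v -> v \in B = false.
  by move=> uA euv; apply/negP => vB; have := sepE hAB uA vB; rewrite euv.
split; last first.
  have [E K] := card_C_succ W i; rewrite -K [in X in _ = _ + X]E -eX.
  rewrite !card_indicator -!big_split; apply: eq_bigr => v _; rewrite !inE /=.
  case vS: (v \in S i.+1); first by rewrite (ST W vS) (SC W _ vS) andbT.
  by case vT: (v \in T); rewrite andbF /= ?(wf_TC W _ vT) ?orbF ?addn0.
apply: sep_compl.
- rewrite disjoint_subset; apply/subsetP => v; rewrite !inE => /orP[/orP[vS|vC]|/andP[vS vA]].
  + by rewrite (ST W vS) (SC W _ vS) (wf_SS W _ vS) ?andbF.
  + by rewrite (wf_CS W _ vC) (CT W vC) andbF (wf_CC W _ vC) // eq_sym.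
  + rewrite (ST W vS) (SC W _ vS) /=; apply/negP => /andP[/nXA].
    by rewrite vA.
- by have [v vC] := wf_C0 W i.+1; apply/set0Pn; exists v; rewrite !inE vC orbT.
- have [v vC] := wf_C0 W i.+2; apply/set0Pn; exists v.
  by rewrite !inE !(wf_CS W _ vC) (CT W vC) !(wf_CC W _ vC) ?andbF // eq_sym.
move=> u v + vU euv; move: vU; rewrite !inE !negb_or => /andP[/andP[v0 vT] vX].
have nB' : u \in A -> v \in B = false by move/eAB; apply.
have memA : v \in S i.+1 -> u \in A -> v \in A.
  move=> vS /nB' vB; rewrite vS andbT in vX.
  by have := sepD hAB v; rewrite vB (negbTE vX); case: (v \in A).
have nC : u \in A -> v \in C i.+2 = false.
  by move=> /nB' vB; apply/negP => /(subsetP CB); rewrite vB.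
case/orP => [/orP[uS|uC]|/andP[uS uA]].
- have := sepE (sepS W i) uS (y := v); rewrite euv !inE (negbTE vT) (negbTE v0) /=.
  case: (v \in S i) => //; case: (v \in C i.+1) => //= /(_ isT) //.
- have uD : u \in double_sector C S i by rewrite !inE uC orbT.
  have uA := subsetP CA _ uC.
  have := sepE (wf_sep W i) uD (y := v); rewrite euv !inE (negbTE vT) (negbTE v0) (nC uA) /=.
  case vS: (v \in S i.+1); first by rewrite memA ?orbT.
  by case: (v \in S i) => //; case: (v \in C i.+1) => //= /(_ isT).
have := sepE (sepS W i.+1) uS (y := v); rewrite euv !inE (negbTE vT) (nC uA) /=.
case vS: (v \in S i.+1); first by rewrite memA ?orbT.
by case: (v \in C i.+1); rewrite ?orbT // => /(_ isT).
Qed.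

End Halves.

(** * Wheels as sequences, as periodic families, and their rotations *)

Lemma cyc_mod (s : seq {set V}) k l : k = l %[mod size s] -> cyc s k = cyc s l.
Proof. by rewrite /cyc => ->. Qed.

Lemma disjoint_intro (P Q : {set V}) : (forall v, v \in P -> v \in Q = false) -> [disjoint P & Q].
Proof. by move=> h; rewrite disjoint_subset; apply/subsetP => v /h; rewrite inE => ->. Qed.

Lemma is_wheel_fam cs ss : is_wheel e T cs ss ->
  wheel_fam e T (size cs) (cyc cs) (cyc ss).
Proof.
move=> [w4 [eqs [ne [dis [dT [cov cut]]]]]]; have w0 : 0 < size cs by nlia.
have modw k : k %% size cs < size cs by rewrite ltn_mod.
have pC k : cyc cs (k %% size cs) = cyc cs k by apply: cyc_mod; rewrite modn_mod.
have pS k : cyc ss (k %% size cs) = cyc ss k by apply: cyc_mod; rewrite eqs modn_mod.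
split=> //.
- by move=> k; have [/set0Pn + _] := ne _ (modw k); rewrite pC.
- by move=> k; have [_ /set0Pn] := ne _ (modw k); rewrite pS.
- by move=> k l E; apply: cyc_mod.
- by move=> k l E; apply: cyc_mod; rewrite eqs.
- move=> k l v kl; have [_ /(_ kl) [d _]] := dis _ _ (modw k) (modw l).
  by rewrite !pC in d; apply: disjointFr.
- move=> k l v kl; have [_ /(_ kl) [_ d]] := dis _ _ (modw k) (modw l).
  by rewrite !pS in d; apply: disjointFr.
- move=> k l v; have [d _] := dis _ _ (modw k) (modw l).
  by rewrite pC pS in d; apply: disjointFr.
- move=> k v vT; have := disjointFr (dT _ (modw k)) vT.
  by rewrite pC pS inE => /norP[/negbTE].
- move=> k v vT; have := disjointFr (dT _ (modw k)) vT.
  by rewrite pC pS inE => /norP[_ /negbTE].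
- move=> v; have [|[k _]] := cov v; first by left.
  by rewrite inE => /orP H; right; exists k.
- move=> k; have [_ /disconnects_sep] := cut _ (modw k).
  have m1 : (k %% size cs).+1 = k.+1 %[mod size cs].
    by apply/eqP; rewrite -addn1 -(addn1 k) eqn_modDr modn_mod.
  have m2 : (k %% size cs).+2 = k.+2 %[mod size cs].
    by apply/eqP; rewrite -addn2 -(addn2 k) eqn_modDr modn_mod.
  have m3 : (k %% size cs).+1 = k.+1 %[mod size ss] by rewrite eqs.
  by rewrite /Cij pC pS (cyc_mod m1) (cyc_mod m2) (cyc_mod m3).
- move=> k; have [/andP[_ /eqP E] _] := cut _ (modw k); move: E.
  have m2 : (k %% size cs).+2 = k.+2 %[mod size cs].
    by apply/eqP; rewrite -addn2 -(addn2 k) eqn_modDr modn_mod.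
  by rewrite /Cij pC (cyc_mod m2).
Qed.

Lemma fam_is_wheel cs ss : size ss = size cs ->
  wheel_fam e T (size cs) (cyc cs) (cyc ss) -> is_wheel e T cs ss.
Proof.
move=> eqs W; have w4 := wf_w W; have w0 : 0 < size cs by nlia.
split=> //; split=> //; split; [|split; [|split; [|split]]].
- by move=> i _; split; apply/set0Pn; [apply: wf_C0 W _|apply: wf_S0 W _].
- move=> i j iw jw; split; first by apply: disjoint_intro => v; apply: wf_CS W _ _ v.
  move=> ij; have {}ij : i != j %[mod size cs] by rewrite !modn_small.
  by split; apply: disjoint_intro => v; [apply: (wf_CC W)|apply: (wf_SS W)].
- move=> i iw; apply: disjoint_intro => v vT.
  by rewrite inE (wf_TC W _ vT) (wf_TS W _ vT).
- move=> v; have [|[k H]] := wf_cover W v; [by left|right].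
  exists (k %% size cs); first by rewrite ltn_mod.
  by rewrite (cyc_mod (l := k)) ?modn_mod // (cyc_mod (s := ss) (l := k)) ?eqs ?modn_mod // inE;
     apply/orP.
move=> i iw; split; last exact: sep_disconnects (wf_sep W i).
exact: kcut_sep (wf_sep W i) (wf_card W i).
Qed.

Lemma cyc_rot n (s : seq {set V}) i : n <= size s -> cyc (rot n s) i = cyc s (n + i).
Proof.
move=> ns; rewrite /cyc size_rot; case: (posnP (size s)) => [/size0nil ->|s0].
  by rewrite /= !nth_nil.
have iw : i %% size s < size s by rewrite ltn_mod.
rewrite -modnDmr; move: (i %% size s) iw => j jw.
rewrite /rot nth_cat size_drop; case: ltnP => h.
  by rewrite nth_drop modn_small //; nlia.
rewrite nth_take; last nlia.
have -> : n + j = size s + (j - (size s - n)) by nlia.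
by rewrite modnDl modn_small //; nlia.
Qed.

Lemma is_wheel_rot n cs ss : n <= size cs -> is_wheel e T cs ss ->
  is_wheel e T (rot n cs) (rot n ss).
Proof.
move=> nw hw; have [_ [eqs _]] := hw; have W := is_wheel_fam hw.
apply: fam_is_wheel; rewrite !size_rot //.
have rC k : cyc (rot n cs) k = cyc cs (n + k) by apply: cyc_rot.
have rS k : cyc (rot n ss) k = cyc ss (n + k) by apply: cyc_rot; rewrite eqs.
have w0 : 0 < size cs by have := wf_w W; nlia.
have shift k l : k != l %[mod size cs] -> n + k != n + l %[mod size cs] by rewrite eqn_modDl.
have shifte k l : k = l %[mod size cs] -> n + k = n + l %[mod size cs].
  by move=> E; apply/eqP; rewrite eqn_modDl; apply/eqP.
split.
- exact: wf_w W.
- by move=> k; rewrite rC; apply: wf_C0 W _.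
- by move=> k; rewrite rS; apply: wf_S0 W _.
- by move=> k l /shifte; rewrite !rC; apply: wf_Cper W _ _.
- by move=> k l /shifte; rewrite !rS; apply: wf_Sper W _ _.
- by move=> k l v /shift; rewrite !rC; apply: wf_CC W _ _ _.
- by move=> k l v /shift; rewrite !rS; apply: wf_SS W _ _ _.
- by move=> k l v; rewrite rC rS; apply: wf_CS W _ _ _.
- by move=> k v; rewrite rC; apply: wf_TC W _ _.
- by move=> k v; rewrite rS; apply: wf_TS W _ _.
- move=> v; have [|[k H]] := wf_cover W v; [by left|right].
  have [m mk] : exists m, n + m = k %[mod size cs].
    exists (k + (size cs - n)); rewrite addnC -addnA subnK // modnDr.
    by [].
  by exists m; rewrite rC rS (wf_Cper W mk) (wf_Sper W mk).
- by move=> k; rewrite /double_sector /spokes !rC !rS !addnS; apply: wf_sep W _.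
- by move=> k; rewrite /spokes !rC !addnS; apply: wf_card W _.
Qed.

(** * Inserting one or two spokes *)

Lemma cyc_nth (s : seq {set V}) i : i < size s -> cyc s i = nth set0 s i.
Proof. by move=> h; rewrite /cyc modn_small. Qed.

(** Splitting the last sector puts the new spoke at the head of the list, so all old spokes and the
    uncut sectors move up by one index; the halves of [Z] become the first and the last sector. *)
Lemma insert_last cs ss X A B Z : is_wheel e T cs (rcons ss Z) -> sep e A X B ->
  split_at (cyc cs) (cyc (rcons ss Z)) X (size ss) A B ->
  is_wheel e T (X :&: Z :: cs) (Z :&: B :: rcons ss (Z :&: A)).
Proof.
move=> hw hAB sp; have [_ [eqs _]] := hw; rewrite size_rcons in eqs.
have W := is_wheel_fam hw; have w4 := wf_w W.
set C := cyc cs in W sp; set S := cyc (rcons ss Z) in W sp; set w := size cs in eqs w4 W.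
set C' := cyc (X :&: Z :: cs); set S' := cyc (Z :&: B :: rcons ss (Z :&: A)).
have C'0 : C' 0 = X :&: Z by rewrite /C' cyc_nth.
have S'0 : S' 0 = Z :&: B by rewrite /S' cyc_nth.
have C'S k : k < w -> C' k.+1 = C k by move=> kw; rewrite /C' /C !cyc_nth.
have eZ : S (size ss) = Z by rewrite /S cyc_nth ?size_rcons // nth_rcons ltnn eqxx.
have S'S k : k < size ss -> S' k.+1 = S k.
  move=> kw; rewrite /S' /S !cyc_nth /= ?size_rcons ?ltnS //; try nlia.
  by rewrite !nth_rcons kw.
have S'w : S' w = Z :&: A.
  by rewrite /S' -eqs cyc_nth /= ?size_rcons // nth_rcons ltnn eqxx.
have C'per k : C' (k + w.+1) = C' k by apply: cyc_mod; rewrite modnDr.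
have S'per k : S' (k + w.+1) = S' k.
  by apply: cyc_mod; rewrite /= size_rcons eqs modnDr.
(* New sector [k] lies in the old sector before [k]; adding [w.-1] subtracts one modulo [w]. *)
have mem k v : k <= w -> v \in S' k -> v \in S (k + w.-1).
  case: k => [|k] kw; first by rewrite S'0 add0n -eqs -pred_Sn eZ inE => /andP[].
  have -> : S (k.+1 + w.-1) = S k.
    by apply: (wf_Sper W); rewrite addSnnS prednK ?modnDr //; nlia.
  have [ks|ks] := ltnP k (size ss); first by rewrite S'S.
  have -> : k = size ss by nlia.
  by rewrite eqs S'w eZ inE => /andP[].
have eqw : size ss = w.-1 by nlia.
have idx k l : k < w -> l < w -> k != l -> k != l %[mod w].
  by move=> kw lw; rewrite !modn_small.
have SSx k l v : k < w -> l < w -> k != l -> v \in S k -> v \in S l -> False.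
  by move=> kw lw kl vk; rewrite (wf_SS W (idx _ _ kw lw kl) vk).
have CCx k l v : k < w -> l < w -> k != l -> v \in C k -> v \in C l -> False.
  by move=> kw lw kl vk; rewrite (wf_CC W (idx _ _ kw lw kl) vk).
have [CA CB eX nA nB] := sp; rewrite eZ in eX nA nB.
have nAB v : v \in A -> v \in B = false by have := sepD hAB v; do ![case: (v \in _)].
have nXB v : v \in X -> v \in B = false by have := sepD hAB v; do ![case: (v \in _)].
have nXA v : v \in X -> v \in A = false by have := sepD hAB v; do ![case: (v \in _)].
have c0 : 0 < #|C (size ss)| by apply/card_gt0P; apply: wf_C0 W _.
have CS' i j v : i <= w -> j <= w -> v \in C' i -> v \in S' j -> False.
  move=> iw jw; case: i iw => [_|i iw]; last first.
    by rewrite C'S // => vC /(mem _ _ jw); rewrite (wf_CS W _ vC).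
  rewrite C'0 inE => /andP[vX vZ]; case: j jw => [_|j jw].
    by rewrite S'0 inE nXB ?andbF.
  have [js|js] := ltnP j (size ss).
    rewrite S'S // => vS; rewrite -eZ in vZ.
    by apply: (SSx j (size ss)) vS vZ; nlia.
  have -> : j.+1 = w by nlia.
  by rewrite S'w inE nXA ?andbF.
have CC' i j v : i < j -> j <= w -> v \in C' i -> v \in C' j -> False.
  case: j => // j; case: i => [_ jw|i ij jw].
    by rewrite C'0 C'S // inE -eZ => /andP[_ vS]; rewrite (SC W _ vS).
  rewrite !C'S // => [vi vj|]; last by nlia.
  by apply: (CCx i j) vi vj; nlia.
have SS' i j v : i < j -> j <= w -> v \in S' i -> v \in S' j -> False.
  case: j => // j; case: i => [_ jw|i ij jw].
    rewrite S'0 inE => /andP[vZ vB]; have [js|js] := ltnP j (size ss).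
      rewrite S'S // => vS; rewrite -eZ in vZ.
      by apply: (SSx j (size ss)) vS vZ; nlia.
    have -> : j.+1 = w by nlia.
    rewrite S'w inE => /andP[_ /nAB]; by rewrite vB.
  rewrite S'S => [vi|]; last by nlia.
  have [js|js] := ltnP j (size ss).
    rewrite S'S // => vS.
    by apply: (SSx j i) vS vi; nlia.
  have -> : j.+1 = w by nlia.
  rewrite S'w inE -eZ => /andP[vS _].
  by apply: (SSx i (size ss)) vi vS; nlia.
have dj (P Q : {set V}) : (forall v, v \in P -> v \in Q -> False) -> [disjoint P & Q].
  by move=> h; apply: disjoint_intro => v vP; apply/negP => vQ; apply: h vP vQ.
split; first by rewrite /=; nlia.
split; first by rewrite /= size_rcons eqs.
rewrite -/C' -/S' /= -/w; split; [|split; [|split; [|split]]].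
- move=> i iw; split.
    case: i iw => [|i] iw; last by rewrite C'S //; apply/set0Pn; apply: wf_C0 W _.
    by rewrite C'0 -card_gt0 eX.
  case: i iw => [|i] iw; first by rewrite S'0.
  have [js|js] := ltnP i (size ss); first by rewrite S'S //; apply/set0Pn; apply: wf_S0 W _.
  have -> : i.+1 = w by nlia.
  by rewrite S'w.
- move=> i j iw jw; split; first by apply: dj => v; apply: CS'; nlia.
  rewrite neq_ltn => /orP[] ij; split; apply: dj => v h1 h2.
  + by apply: (CC' i j) h1 h2; nlia.
  + by apply: (SS' i j) h1 h2; nlia.
  + by apply: (CC' j i) h2 h1; nlia.
  + by apply: (SS' j i) h2 h1; nlia.
- move=> i iw; apply: disjoint_intro => v vT; rewrite inE.
  apply/norP; split; last first.
    by apply/negP => /mem; rewrite (wf_TS W _ vT) => H; have := H iw.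
  case: i iw => [|i] iw; last by rewrite C'S // (wf_TC W _ vT).
  by rewrite C'0 inE -eZ (wf_TS W _ vT) andbF.
- move=> v; have [|[k H]] := wf_cover W v; [by left|right; move: H].
  have kw : k %% w < w by rewrite ltn_mod; nlia.
  rewrite -(wf_Cper W (modn_mod k w)) -(wf_Sper W (modn_mod k w)).
  move: (k %% w) kw => {}k kw [vC|vS]; first by exists k.+1; rewrite ?ltnS // inE C'S ?vC.
  have [js|js] := ltnP k (size ss).
    by exists k.+1; rewrite ?ltnS // inE S'S // vS orbT.
  have ek : k = size ss by nlia.
  rewrite ek eZ in vS.
  have := sepD hAB v; case vA: (v \in A).
    by exists w => //; apply/setUP; right; rewrite S'w in_setI vS vA.
  case vX: (v \in X); first by exists 0 => //; apply/setUP; left; rewrite C'0 in_setI vS vX.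
  by case vB: (v \in B) => // _; exists 0 => //; apply/setUP; right; rewrite S'0 in_setI vS vB.
have finish (P U : {set V}) R : sep e P U R -> #|U| = kappa e -> kcut e U /\ disconnects e U P.
  by move=> h cU; split; [apply: kcut_sep h cU|apply: sep_disconnects h].
have CP k : C (size ss + k.+1) = C k.
  by apply: (wf_Cper W); rewrite -addSnnS eqs modnDl.
have SP k : S (size ss + k.+1) = S k.
  by apply: (wf_Sper W); rewrite -addSnnS eqs modnDl.
have wE : size ss = (w - 2).+1 by nlia.
move=> i iw; rewrite /Cij -/C'.
(* Four kinds of index: 0 uses the right half, [size ss] the left half, those in between an old
   double sector, and [w] the sector [Z] itself, whose halves the new spoke rejoins. *)
have [i0|i0] := posnP i.
  subst i; rewrite C'0 S'0 !C'S ?S'S; try nlia.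
  have [h1 h2] := right_half_sep W hAB sp.
  move: h1 h2; rewrite eZ.
  have := CP 0; rewrite addn1 => ->; have := CP 1; rewrite addn2 => ->.
  have := SP 0; rewrite addn1 => ->.
  exact: finish.
have [i1|i1] := ltnP i (size ss).
  case: i i0 i1 iw => // i _ i1 iw; rewrite !C'S ?S'S; try nlia.
  exact: finish (wf_sep W i) (wf_card W i).
have [i2|i2] := eqVneq i (size ss).
  have C'w2 : C' i.+2 = X :&: Z by rewrite -C'0 -(C'per 0) add0n i2 eqs.
  have S'w1 : S' i.+1 = Z :&: A by rewrite i2 eqs S'w.
  rewrite C'w2 S'w1 i2 wE !C'S ?S'S; try nlia.
  rewrite wE in sp; have [h1 h2] := left_half_sep W hAB sp.
  rewrite -wE eZ wE in h1 h2; exact: finish h1 h2.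
have iE : i = w by nlia.
have E0 : C' i.+2 = C 0 by rewrite -(C'S 0) -1?(C'per 1) ?iE ?add1n //; nlia.
have E1 : C' i.+1 = X :&: Z by rewrite -C'0 -(C'per 0) iE.
have E2 : S' i.+1 = Z :&: B by rewrite -S'0 -(S'per 0) iE.
rewrite E0 E1 E2 iE S'w -eqs C'S; last nlia.
have h := sepS W (size ss); have k := card_spokes1 W (size ss).
have := CP 0; rewrite addn1 => E; rewrite /spokes E eZ in h k.
have -> : Z :&: A :|: X :&: Z :|: Z :&: B = Z.
  by apply/setP => v; rewrite !inE; have := sepD hAB v; do ![case: (v \in _)].
exact: finish h k.
Qed.

(** Sector [i] is rotated to the end, split by [insert_last], and the result is rotated back. *)
Lemma insert_wheel cs ss X A B i : is_wheel e T cs ss -> sep e A X B ->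
  i < size cs -> split_at (cyc cs) (cyc ss) X i A B ->
  is_wheel e T (take i.+1 cs ++ X :&: cyc ss i :: drop i.+1 cs)
    (take i ss ++ cyc ss i :&: A :: cyc ss i :&: B :: drop i.+1 ss).
Proof.
move=> hw hAB iw sp; have [_ [eqs _]] := hw; have is_ : i < size ss by rewrite eqs.
have hr := is_wheel_rot iw hw.
have er : rot i.+1 ss = rcons (drop i.+1 ss ++ take i ss) (cyc ss i).
  by rewrite /rot (take_nth set0 is_) -(cyc_nth is_) rcons_cat.
have sz : size (drop i.+1 ss ++ take i ss) = (size cs).-1.
  by rewrite size_cat size_drop size_take is_ eqs; nlia.
have rC k : cyc (rot i.+1 cs) k = cyc cs (i.+1 + k) by apply: cyc_rot.
have rS k : cyc (rot i.+1 ss) k = cyc ss (i.+1 + k) by apply: cyc_rot; rewrite eqs.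
have m1 : i.+1 + (size cs).-1 = i %[mod size cs].
  by rewrite addSnnS prednK ?modnDr //; nlia.
have m2 : i.+1 + (size cs) = i.+1 %[mod size cs] by rewrite modnDr.
have sp' : split_at (cyc (rot i.+1 cs)) (cyc (rcons (drop i.+1 ss ++ take i ss) (cyc ss i)))
    X (size (drop i.+1 ss ++ take i ss)) A B.
  rewrite /split_at -er sz prednK; last nlia.
  by rewrite !rC rS (cyc_mod m1) (cyc_mod m2) (@cyc_mod ss _ i) ?eqs.
rewrite er in hr; have := insert_last hr hAB sp'.
(* Rotating past the new spoke and [drop i.+1 cs] brings [take i.+1 cs] back to the front. *)
move=> /(@is_wheel_rot (size (drop i.+1 cs)).+1) H.
have {H} := H _; rewrite /= size_rot ltnS size_drop => /(_ (leq_subr _ _)).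
set n := (_ - _).+1.
have -> : rot n (X :&: cyc ss i :: rot i.+1 cs) = take i.+1 cs ++ X :&: cyc ss i :: drop i.+1 cs.
  by rewrite -[_ :: rot _ _]/((_ :: drop i.+1 cs) ++ take i.+1 cs) -(rot_size_cat (_ :: _)) /= size_drop.
suff -> : rot n (cyc ss i :&: B :: rcons (drop i.+1 ss ++ take i ss) (cyc ss i :&: A))
   = take i ss ++ cyc ss i :&: A :: cyc ss i :&: B :: drop i.+1 ss by [].
rewrite rcons_cat -cat_cons -(cat_rcons _ (take i ss)) -(rot_size_cat (_ :: drop i.+1 ss)) /= size_drop.
by rewrite eqs.
Qed.

(** Inserting at the larger index [j] first leaves sector [i] and the spokes up to [j] in place. *)
Lemma insert_two cs ss X A B i j : is_wheel e T cs ss -> sep e A X B -> i < j < size cs ->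
  split_at (cyc cs) (cyc ss) X i A B -> split_at (cyc cs) (cyc ss) X j B A ->
  forms_wheel e T (take i.+1 cs ++ (X :&: cyc ss i)
                     :: drop i.+1 (take j.+1 cs) ++ (X :&: cyc ss j) :: drop j.+1 cs).
Proof.
move=> hw hAB /andP[ij jw] si sj; have [_ [eqs _]] := hw.
have hj := insert_wheel hw (sepC esym hAB) jw sj; have [_ [eqs' _]] := hj.
set cs' := _ ++ _ in hj eqs'; set ss' := _ ++ _ in hj eqs'.
have sz : size (take j.+1 cs) = j.+1 by rewrite size_takel.
have szs : size (take j ss) = j by rewrite size_takel // eqs ltnW.
have sz' : size cs' = (size cs).+1 by rewrite size_cat /= sz size_drop; nlia.
have eC k : k <= j -> cyc cs' k = cyc cs k.
  move=> kj; rewrite !cyc_nth ?sz'; try nlia.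
  by rewrite nth_cat sz ltnS kj nth_take.
have eS : cyc ss' i = cyc ss i.
  by rewrite !cyc_nth ?eqs' ?sz' ?eqs; try nlia; rewrite nth_cat szs ij nth_take.
have si' : split_at (cyc cs') (cyc ss') X i A B.
  by rewrite /split_at eS !eC // ltnW.
have iw' : i < size cs' by nlia.
have hij := insert_wheel hj hAB iw' si'; rewrite eS in hij.
have et : take i.+1 cs' = take i.+1 cs.
  by rewrite takel_cat ?sz; [rewrite take_takel // ltnW|nlia].
have ed : drop i.+1 cs' = drop i.+1 (take j.+1 cs) ++ X :&: cyc ss j :: drop j.+1 cs.
  by rewrite drop_cat sz ltnS ij.
by rewrite et ed in hij; eexists; apply: hij.
Qed.

End Insertion.

(** * Collecting the alternatives *)

Lemma sum_card_disjoint (V : finType) n (P : pred 'I_n) (F : 'I_n -> {set V}) (X : {set V}) :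
  (forall k, P k -> F k \subset X) -> (forall k l, k != l -> [disjoint F k & F l]) ->
  \sum_(k < n | P k) #|F k| <= #|X|.
Proof.
move=> sub dis; under eq_bigr => k _ do rewrite card_indicator.
rewrite exchange_big card_indicator; apply: leq_sum => v _ /=.
have [/existsP[k /andP[Pk vk]]|] := boolP [exists k, P k && (v \in F k)].
  rewrite (bigD1 k) //= vk (subsetP (sub _ Pk) _ vk) big1 // => l /andP[_ lk].
  by rewrite (disjointFr (dis k l _) vk) // eq_sym.
rewrite negb_exists => /forallP h; rewrite big1 // => k Pk.
by have := h k; rewrite Pk /= => /negbTE ->.
Qed.

Theorem theorem3 (V : finType) (e : rel V) (T : {set V}) (cs ss : seq {set V})
    (X : {set V}) :
  symmetric e -> irreflexive e ->
  (forall x y, connect e x y) ->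
  (exists x y, x != y /\ ~~ e x y) ->
  4 * kappa e < #|V| ->
  is_wheel e T cs ss ->
  kcut e X ->
  (* 1 *)
  (exists i j, i < size cs /\ j < size cs /\ i != j /\ X = Cij T cs i j) \/
  (* 2 *)
  (exists2 i, i < size cs & X \subset Cij T cs i i.+1 :|: cyc ss i) \/
  (* 3 *)
  (exists i, i < size cs /\
     exists U A P, (U = Cij T cs i i.+1 \/ U = Cij T cs i i.+2) /\
       crossing_matching_cut e U A P X) \/
  (* 4 *)
  small_cut e (kappa e - 1) X \/
  (* 5 *)
  small_wheel e ss \/
  (* 6 *)
  (exists i j, i < j < size cs /\
     X \subset cyc ss i :|: T :|: cyc ss j /\
     forms_wheel e T (take i.+1 cs ++ (X :&: cyc ss i)
                        :: drop i.+1 (take j.+1 cs) ++ (X :&: cyc ss j)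
                        :: drop j.+1 cs)) \/
  (exists i j, i < size cs /\ j < size cs /\ i != j /\
     X \subset cyc ss i :|: T :|: cyc cs j /\
     forms_wheel e T (take i.+1 cs ++ (X :&: cyc ss i) :: drop i.+1 cs)).
Proof.
move=> esym _ _ _ big hw kX; have [_ [eqs _]] := hw; have W := is_wheel_fam hw.
have w4 := wf_w W; have w0 : 0 < size cs by nlia.
have [small|[A [B hAB]]] := not_small_big_sep esym big kX.
  by do 3!right; left.
have [_ cX _ _] := hAB.
have mw k : k %% size cs < size cs by rewrite ltn_mod.
have mm k : k %% size cs = k %[mod size cs] by rewrite modn_mod.
have mmD k d : d + k %% size cs = d + k %[mod size cs] by rewrite modnDmr.
have mC k : cyc cs (k %% size cs) = cyc cs k := wf_Cper W (mm k).
have mS k : cyc ss (k %% size cs) = cyc ss k := wf_Sper W (mm k).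
have mC1 k : cyc cs (k %% size cs).+1 = cyc cs k.+1 := wf_Cper W (mmD k 1).
have mC2 k : cyc cs (k %% size cs).+2 = cyc cs k.+2 := wf_Cper W (mmD k 2).
have split_mod i A' B' : split_at (cyc cs) (cyc ss) X i A' B' ->
    split_at (cyc cs) (cyc ss) X (i %% size cs) A' B'.
  by rewrite /split_at mC mS mC1.
(* [G] abbreviates the goal. The case analysis yields indices in [nat], while the alternatives ask
   for indices below [size cs], so each index is reduced modulo [size cs]. *)
move: hAB; set G := (X in _ -> X) => hAB.
have c1 i j : i != j %[mod size cs] -> X = spokes T (cyc cs) i j -> G.
  move=> ij E; left; exists (i %% size cs), (j %% size cs).
  by rewrite !mw ij /Cij !mC.
have c2 i : X \subset spokes T (cyc cs) i i.+1 :|: cyc ss i -> G.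
  move=> E; right; left; exists (i %% size cs); first exact: mw.
  by rewrite /Cij mC mC1 mS.
have c3 i U D P : U = spokes T (cyc cs) i i.+1 \/ U = spokes T (cyc cs) i i.+2 ->
    crossing_matching_cut e U D P X -> G.
  move=> hU cmc; do 2!right; left; exists (i %% size cs); split; first exact: mw.
  by exists U, D, P; rewrite /Cij mC mC1 mC2.
have c5 i : (forall k, i != k %[mod size cs] -> cyc ss k \subset X) -> G.
  move=> sub; do 4!right; left; exists (i %% size cs); first by rewrite eqs.
  (* The sectors in the sum are disjoint subsets of [X], so they total at most [#|X|], which is
     kappa. *)
  rewrite -cX.
  apply: (sum_card_disjoint (F := fun k : 'I_(size ss) => nth set0 ss k)).
    move=> k ik; rewrite -cyc_nth //; apply: sub.
    have kw : k < size cs by rewrite -eqs.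
    by rewrite [k %% _]modn_small // eq_sym.
  move=> k l kl; rewrite -!cyc_nth //; apply: disjoint_intro => v; apply: (wf_SS W).
  by rewrite -eqs !modn_small.
have [//|[i [d [A' [B' [dw hs si sj sub]]]]]|[i [m [A' [B' [m1 hs si sub]]]]]] :=
  wheel_cut_cases esym W c1 c2 c3 c5 hAB.
- do 5!right; left.
  have ij : i %% size cs != (d + i) %% size cs.
    by apply: (offset_mod i (m := 0) (n := d)); nlia.
  have si' := split_mod _ _ _ si; have sj' := split_mod _ _ _ sj.
  (* The residues may come in either order; in the second one [A'] and [B'] are exchanged. *)
  move: ij; rewrite neq_ltn => /orP[] ij.
    exists (i %% size cs), ((d + i) %% size cs); rewrite ij mw !mS; split=> //; split=> //.
    by have := insert_two esym hw hs _ si' sj'; rewrite ij mw !mS; apply.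
  exists ((d + i) %% size cs), (i %% size cs); rewrite ij mw !mS; split=> //.
  split; first by rewrite setUC (setUC _ T) setUA.
  by have := insert_two esym hw (sepC esym hs) _ sj' si'; rewrite ij mw !mS; apply.
do 6!right; exists (i %% size cs), ((m + i) %% size cs).
have ij : i %% size cs != (m + i) %% size cs.
  by apply: (offset_mod i (m := 0) (n := m)); nlia.
rewrite !mw ij mS mC; do 4!split=> //.
have := insert_wheel esym hw hs (mw i) (split_mod _ _ _ si); rewrite mS => H.
by eexists; apply: H.
Qed.
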